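(* Let $y\in M$ be such that $({\rm A}_y^+)$ holds with the fundamental solution $\Gamma=\Gamma_y$ in $T_y$. Let $\Omega\subset T_y$, $y\notin\partial\Omega$, be a strongly admissible domain (with $y$), let $\alpha\in\mathbb{R}$, $\beta>\alpha>4-\beta$, $\beta>2$ and $R\ge e\,\sup_{\Omega}\Gamma^{\frac{1}{2-\beta}}$. Let $u\in C^2(\Omega)\cap C^1(\overline{\Omega})$, and set $$\mathcal{C}(u):=\frac{\alpha-2}{2-\beta}\int_{\partial\Omega}u^2\,\Gamma^{\frac{\alpha-2}{2-\beta}-1}\langle\widetilde{\nabla}\Gamma,d\nu\rangle-2\int_{\partial\Omega}\Gamma^{\frac{\alpha-2}{2-\beta}}u\langle\widetilde{\nabla}u,d\nu\rangle .$$ Then $$\int_{\Omega}\frac{\Gamma^{\frac{\alpha}{2-\beta}}}{|\nabla_X\Gamma^{\frac{1}{2-\beta}}|^2}|\mathcal{L}u|^2\,d\nu\ge\frac{(\beta+\alpha-4)^2(\beta-\alpha)^2}{16}\int_{\Omega}\Gamma^{\frac{\alpha-4}{2-\beta}}|\nabla_X\Gamma^{\frac{1}{2-\beta}}|^2|u|^2\,d\nu$$ $$+\frac{(\beta+\alpha-4)^2(\beta-\alpha)}{4(\beta-2)}\int_{\partial\Omega}\Gamma^{\frac{\alpha-2}{2-\beta}-1}|u|^2\langle\widetilde{\nabla}\Gamma,d\nu\rangle+\frac{(\beta+\alpha-4)(\beta-\alpha)}{4}\mathcal{C}(u),$$ and also $$\int_{\Omega}\frac{\Gamma^{\frac{\alpha}{2-\beta}}}{|\nabla_X\Gamma^{\frac{1}{2-\beta}}|^2}|\mathcal{L}u|^2\,d\nu\ge\frac{(\beta+\alpha-4)^2(\beta-\alpha)^2}{16}\int_{\Omega}\Gamma^{\frac{\alpha-4}{2-\beta}}|\nabla_X\Gamma^{\frac{1}{2-\beta}}|^2|u|^2\,d\nu$$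 $$+\frac{(\beta+\alpha-4)(\beta-\alpha)}{8}\int_{\Omega}\Gamma^{\frac{\alpha-4}{2-\beta}}|\nabla_X\Gamma^{\frac{1}{2-\beta}}|^2\left(\ln\frac{R}{\Gamma^{\frac{1}{2-\beta}}}\right)^{-2}|u|^2\,d\nu$$ $$+\frac{(\beta+\alpha-4)(\beta-\alpha)}{4(\beta-2)}\int_{\partial\Omega}\Gamma^{\frac{\alpha-2}{2-\beta}-1}\left(\ln\frac{R}{\Gamma^{\frac{1}{2-\beta}}}\right)^{-1}|u|^2\langle\widetilde{\nabla}\Gamma,d\nu\rangle$$ $$+\frac{(\beta+\alpha-4)^2(\beta-\alpha)}{4(\beta-2)}\int_{\partial\Omega}\Gamma^{\frac{\alpha-2}{2-\beta}-1}|u|^2\langle\widetilde{\nabla}\Gamma,d\nu\rangle+\frac{(\beta+\alpha-4)(\beta-\alpha)}{4}\mathcal{C}(u).$$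
   Context: Let $M$ be a smooth manifold of dimension $n$ with a volume form $d\nu$, let $\{X_k\}_{k=1}^{N}$, $N\le n$, be a family of real vector fields on $M$, and let $\mathcal{L}=\sum_{k=1}^{N}X_k^2$, $\nabla_X=(X_1,\ldots,X_N)$. The spaces $C^{1}$, $C^{2}$ are the spaces of functions with continuous first (respectively, up to second) derivatives with respect to $\{X_k\}$. $\langle X_k,d\nu\rangle$ denotes the duality product (contraction) of the vector field $X_k$ with the $n$-form $d\nu$; it is an $(n-1)$-form. For a function $u$, $\widetilde{\nabla}u=\sum_{k=1}^{N}(X_ku)X_k$, so that $\langle\widetilde{\nabla}u,d\nu\rangle=\sum_{k=1}^N (X_ku)\langle X_k,d\nu\rangle$. Assumption $({\rm A}_y)$ for a point $y\in M$: there is an open set $T_y\subset M$ containing $y$ such that $-\mathcal{L}$ has a fundamental solution in $T_y$, i.e. there is a function $\Gamma_y\in C^2(T_y\setminus\{y\})$ with $-\mathcal{L}\Gamma_y=\delta_y$ in $T_y$, where $\delta_y$ is the Dirac distribution at $y$. Assumption $({\rm A}_y^+)$: $({\rm A}_y)$ holds and, moreover, $\Gamma_y(x)>0$ in $T_y\setminus\{y\}$ and $\frac{1}{\Gamma_y}(y)=0$. Integrals over $\Omega$ involving $\mathcal{L}\Gamma_y$ are interpreted through the identity $-\mathcal{L}\Gamma_y=\delta_y$. Admissible domain: an open bounded set $\Omega\subset M$ whose boundary $\partial\Omega$ has no self-intersections and such that $$\sum_{k=1}^{N}\int_{\Omega}X_kf_k\,d\nu=\sum_{k=1}^{N}\int_{\partial\Omega}f_k\langle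 X_k,d\nu\rangle\qquad( * )$$ for all $f_k\in C^1(\Omega)\cap C(\overline{\Omega})$, $k=1,\ldots,N$. An admissible domain $\Omega$ is strongly admissible with $y\in M$ if $({\rm A}_y)$ is satisfied, $\Omega\subset T_y$, and $( * )$ holds for $f_k=vX_k\Gamma_y$ for all $v\in C^1(\Omega)\cap C(\overline{\Omega})$. *)

(* Defs.v *)
From HB Require Import structures.
From mathcomp Require Import all_boot all_order all_algebra.
From mathcomp Require Import all_classical all_reals all_analysis.
Import Order.TTheory GRing.Theory Num.Theory.
Import numFieldNormedType.Exports.

Set Implicit Arguments.
Unset Strict Implicit.
Unset Printing Implicit Defensive.

Local Open Scope classical_set_scope.
Local Open Scope ring_scope.

(** * Calculus in coordinates *)

Section Coordinates.
Variable R : realType.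

(** [f] is C^k on the open set [U], through iterated partial derivatives. *)
Fixpoint Ck (m : nat) (V : normedModType R) (k : nat) (U : set 'rV[R]_m)
    (f : 'rV[R]_m -> V) : Prop :=
  (forall x, U x -> {for x, continuous f}) /\
  match k with
  | 0 => True
  | k'.+1 => forall j : 'I_m,
      (forall x, U x -> derivable f x (delta_mx 0 j)) /\
      Ck k' U (fun x => 'D_(delta_mx 0 j) f x)
  end.

Definition smooth (m : nat) (V : normedModType R) (U : set 'rV[R]_m)
    (f : 'rV[R]_m -> V) : Prop := forall k, Ck k U f.

(** Lebesgue integral of [f] over [D^m], as an iterated integral.  It is used
    only for nonnegative Borel functions (Tonelli) and for continuous functions
    on a compact cube (Fubini). *)
Fixpoint iterint (D : set R) (m : nat) : ('rV[R]_m -> \bar R) -> \bar R :=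
  match m with
  | 0 => fun f => f 0
  | m'.+1 => fun f =>
      (\int[lebesgue_measure]_(t in D)
         iterint D (fun v : 'rV[R]_m' => f (@row_mx R 1 1 m' t%:M v)))%E
  end.

Definition cube (m : nat) : set 'rV[R]_m :=
  [set t | forall j, 0 <= t 0 j <= 1].
Definition open_cube (m : nat) : set 'rV[R]_m :=
  [set t | forall j, 0 < t 0 j < 1].

End Coordinates.

Arguments cube {R m}.
Arguments open_cube {R m}.

(** * Smooth manifolds, vector fields and volume forms *)

(** A smooth manifold structure of dimension [n] on [M]: a smooth atlas, where
    [crd i] is the coordinate map on [dom i] and [par i] its inverse. *)
Record manifold (R : realType) (n : nat) (M : ptopologicalType) := Manifold {
  chart : Type;
  dom : chart -> set M;
  crd : chart -> M -> 'rV[R]_n;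
  par : chart -> 'rV[R]_n -> M;
  chart_at : M -> chart;
  manifold_hausdorff : hausdorff_space M;
  manifold_second_countable : @second_countable M;
  chart_atP : forall x, dom (chart_at x) x;
  dom_open : forall i, open (dom i);
  crd_open : forall i, open (crd i @` dom i);
  crdK : forall i x, dom i x -> par i (crd i x) = x;
  crd_continuous : forall i x, dom i x -> {for x, continuous (crd i)};
  par_continuous : forall i x, dom i x -> {for crd i x, continuous (par i)};
  transition_smooth : forall i j, smooth (crd i @` (dom i `&` dom j)) (crd j \o par i)
}.

(** Smooth vector fields, by their components in every chart, which transform
    by the differentials of the changes of coordinates. *)
Record vector_field (R : realType) (n : nat) (M : ptopologicalType)
    (A : manifold R n M) := VectorField {
  vf :> chart A -> M -> 'rV[R]_n;
  vf_smooth : forall i, smooth (crd i @` dom i) (vf i \o par i);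
  vfE : forall i j x, dom i x -> dom j x ->
        vf j x = 'd (crd j \o par i) (crd i x) (vf i x)
}.

(** Volume forms: in the chart [i] the form is
    [vol i * dx_1 /\ ... /\ dx_n], with a nonvanishing smooth coefficient. *)
Record volume_form (R : realType) (n : nat) (M : ptopologicalType)
    (A : manifold R n M) := VolumeForm {
  vol :> chart A -> M -> R;
  vol_smooth : forall i, smooth (crd i @` dom i) (vol i \o par i : _ -> R^o);
  vol_neq0 : forall i x, dom i x -> vol i x != 0;
  volE : forall i j x, dom i x -> dom j x ->
        vol i x = vol j x * \det (jacobian (crd j \o par i) (crd i x))
}.

Definition borel (M : ptopologicalType) := g_sigma_algebraType (@open M).

Section VectorFields.
Variables (R : realType) (n : nat) (M : ptopologicalType).
Variables (A : manifold R n M).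

(** The Borel measure of the volume form; integrals of functions against the
    volume form are integrals with respect to this measure. *)
Definition is_volume_measure (w : volume_form A)
    (nu : {measure set (borel M) -> \bar R}) : Prop :=
  forall (i : chart A) (B : set (borel M)), measurable B -> B `<=` dom i ->
    nu B = iterint setT
      (fun v => (`|w i (par i v)| * \1_(crd i @` B) v)%:E).

(** [c] is, near time 0, an integral curve of [V] starting at [x]. *)
Definition integral_curve (V : vector_field A) (x : M) (c : R -> M) : Prop :=
  c 0 = x /\
  \forall t \near (0 : R), {for t, continuous c} /\
    forall i, dom i (c t) -> is_derive (t : R^o) 1 (crd i \o c) (V i (c t)).

(** [V u (x) = l], the derivative being taken along the integral curve of [V]:
    this makes sense for functions that have derivatives only in the directions
    of the given vector fields.  By Cauchy-Lipschitz there is always an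
    integral curve, and it is unique near time 0. *)
Definition is_Xder (V : vector_field A) (u : M -> R) (x : M) (l : R) : Prop :=
  (exists c, integral_curve V x c) /\
  forall c, integral_curve V x c -> is_derive (0 : R^o) 1 (u \o c : R^o -> R^o) l.

Definition Xder (V : vector_field A) (u : M -> R) (x : M) : R :=
  xget 0 [set l | is_Xder V u x l].

Definition Xderivable (V : vector_field A) (u : M -> R) (x : M) : Prop :=
  exists l, is_Xder V u x l.

(** C^oo functions with compact support in [T]. *)
Definition test_function (T : set M) (phi : M -> R) : Prop :=
  (forall i : chart A, smooth (crd i @` dom i) (phi \o par i : _ -> R^o)) /\
  exists K, [/\ compact K, K `<=` T & forall x, ~ K x -> phi x = 0].

Variable nu : {measure set (borel M) -> \bar R}.

(** [g] is the image of the test function [phi] under the formal transpose of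
    [V] with respect to [nu]. *)
Definition transpose (T : set M) (V : vector_field A) (phi g : M -> R) : Prop :=
  test_function T g /\
  forall psi, test_function T psi ->
    (\int[nu]_x (Xder V psi x * phi x)%:E = \int[nu]_x (psi x * g x)%:E)%E.

Variables (N : nat) (X : 'I_N -> vector_field A).

Definition C1X (U : set M) (u : M -> R) : Prop :=
  (forall x, U x -> {for x, continuous u}) /\
  forall k x, U x -> Xderivable (X k) u x /\ {for x, continuous (Xder (X k) u)}.

Definition C2X (U : set M) (u : M -> R) : Prop :=
  C1X U u /\ forall k, C1X U (Xder (X k) u).

(** [C^1(closure U)]: [u] and its first derivatives extend continuously. *)
Definition C1Xbar (U : set M) (u : M -> R) : Prop :=
  [/\ C1X U u, {within closure U, continuous u} &
      forall k, exists g : M -> R,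
        {within closure U, continuous g} /\
        forall x, U x -> g x = Xder (X k) u x].

(** Value at a point of the closure of [U] of the continuous extension of a
    function on [U]. *)
Definition bvalue (U : set M) (g : M -> R) (x : M) : R :=
  lim (g @ within U (nbhs x)).

Definition Lop (u : M -> R) (x : M) : R :=
  \sum_(k < N) Xder (X k) (Xder (X k) u) x.

Definition gradX_sqr (u : M -> R) (x : M) : R :=
  \sum_(k < N) Xder (X k) u x ^+ 2.

(** The components of the (not necessarily smooth) field [\sum_k p_k X_k];
    [hfield (fun k => Xder (X k) u)] is the horizontal gradient of [u]. *)
Definition hfield (p : 'I_N -> M -> R) (i : chart A) (x : M) : 'rV[R]_n :=
  \sum_(k < N) p k x *: X k i x.

(** [- L G = delta_y] in [T], in the sense of distributions. *)
Definition fundamental_solution (T : set M) (y : M) (G : M -> R) : Prop :=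
  (forall K : set (borel M), compact (K : set M) -> K `<=` T ->
     nu.-integrable K (EFin \o G)) /\
  forall (phi : M -> R) (g h : 'I_N -> M -> R),
    test_function T phi ->
    (forall k, transpose T (X k) phi (g k)) ->
    (forall k, transpose T (X k) (g k) (h k)) ->
    (\int[nu]_(x in (T : set (borel M))) (G x * - \sum_(k < N) h k x)%:E
       = (phi y)%:E)%E.

Definition assumption_A (y : M) (T : set M) (G : M -> R) : Prop :=
  [/\ open T, T y, C2X (T `\ y) G & fundamental_solution T y G].

(** [1 / G] vanishes at [y] in the sense of its continuous extension, [G]
    itself being defined only away from [y]. *)
Definition assumption_Aplus (y : M) (T : set M) (G : M -> R) : Prop :=
  [/\ assumption_A y T G, forall x, (T `\ y) x -> 0 < G x &
      (G x)^-1 @[x --> y^'] --> (0 : R)].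

End VectorFields.

(** * Boundary integrals and admissible domains *)

(** A piecewise C^1 hypersurface is presented by finitely many patches
    parametrized by the cube of dimension [n - 1], with orientation signs. *)
Record patches (R : realType) (n : nat) (M : ptopologicalType) := Patches {
  npatch : nat;
  psign : 'I_npatch -> bool;
  patch : 'I_npatch -> 'rV[R]_n.-1 -> M
}.

Arguments psign {R n M} p j.
Arguments patch {R n M} p j _.

Section Domains.
Variables (R : realType) (n : nat) (M : ptopologicalType).
Variables (A : manifold R n M) (w : volume_form A).

(** [B] is a piecewise C^1 hypersurface without self-intersections presented by
    [S]: it is a topological manifold of dimension [n - 1] embedded in [M], and
    the patches cover [B] and overlap only along their edges. *)
Definition presents (S : patches R n M) (B : set M) : Prop :=
  [/\ forall j : 'I_(npatch S), exists W : set 'rV[R]_n.-1,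
        [/\ open W, cube `<=` W,
            forall t, W t -> {for t, continuous (patch S j)} &
            forall i : chart A,
              Ck 1 (W `&` patch S j @^-1` dom i) (crd i \o patch S j)],
      forall (j k : 'I_(npatch S)) s t, open_cube s -> cube t ->
        patch S j s = patch S k t -> j = k /\ s = t,
      B = \bigcup_j (patch S j @` cube) &
      forall x, B x -> exists (U : set M) (h : 'rV[R]_n.-1 -> M)
          (g : M -> 'rV[R]_n.-1),
        [/\ open U, U x, continuous h & {within B `&` U, continuous g}] /\
        [/\ forall v, (B `&` U) (h v), cancel h g &
            forall z, (B `&` U) z -> h (g z) = z]].

(** Coefficient of the pullback by [s] of the [(n-1)]-form [<Y, dnu>], that is
    [dnu (Y, d_1 s, ..., d_(n-1) s)], computed in a chart around [s t]. *)
Definition contraction_pullback (Y : chart A -> M -> 'rV[R]_n)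
    (s : 'rV[R]_n.-1 -> M) (t : 'rV[R]_n.-1) : R :=
  let i := chart_at A (s t) in
  w i (s t) * \det (\matrix_(r < n)
    (if r == 0%N :> nat then Y i (s t)
     else 'D_(\row_(k < n.-1) (k.+1 == r :> nat)%:R) (crd i \o s) t)).

(** The integral of [<Y, dnu>] over the hypersurface presented by [S]. *)
Definition surface_integral (S : patches R n M)
    (Y : chart A -> M -> 'rV[R]_n) : R :=
  \sum_(j < npatch S) (-1) ^+ psign S j *
    fine (iterint `[0, 1] (fun t => (contraction_pullback Y (patch S j) t)%:E)).

Variable nu : {measure set (borel M) -> \bar R}.
Variables (N : nat) (X : 'I_N -> vector_field A).

(** The integral over the hypersurface presented by [S] of [f <Y, dnu>], with
    [Y = \sum_k p_k X_k]. *)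
Definition flux (S : patches R n M) (f : M -> R) (p : 'I_N -> M -> R) : R :=
  surface_integral S (fun i x => f x *: hfield X p i x).

Definition single_flux (S : patches R n M) (k : 'I_N) (f : M -> R) : R :=
  surface_integral S (fun i x => f x *: X k i x).

(** Admissible domains, the boundary being presented by [S].  The divergence
    formula is required whenever its left-hand side is meaningful: for
    functions that are C^1 only in the interior the integrand need not be
    integrable.  The formula also forces [S] to carry the boundary orientation,
    as far as it matters for the forms [<X_k, dnu>]. *)
Definition admissible (S : patches R n M) (Omega : set M) : Prop :=
  [/\ open Omega, compact (closure Omega),
      presents S (closure Omega `\` Omega) &
      forall f : 'I_N -> M -> R,
        (forall k, C1X X Omega (f k) /\
                   {within closure Omega, continuous (f k)}) ->
        nu.-integrable (Omega : set (borel M))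
          (EFin \o fun x => \sum_(k < N) Xder (X k) (f k) x) ->
        (\int[nu]_(x in (Omega : set (borel M)))
           (\sum_(k < N) Xder (X k) (f k) x)%:E
         = (\sum_(k < N) single_flux S k (f k))%:E)%E].

(** Strong admissibility: the formula for [f_k = v X_k G].  Here
    [\sum_k X_k f_k = \sum_k (X_k v)(X_k G) + v (L G)], and [- L G = delta_y]
    makes the second term contribute [- v y] when [y] belongs to [Omega].
    The closure of [Omega] lies in [T] so that the boundary integrals of [G]
    and [X_k G] make sense. *)
Definition strongly_admissible (S : patches R n M) (Omega : set M)
    (y : M) (T : set M) (G : M -> R) : Prop :=
  [/\ admissible S Omega, assumption_A nu X y T G, closure Omega `<=` T &
      forall v : M -> R,
        C1X X Omega v -> {within closure Omega, continuous v} ->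
        nu.-integrable (Omega : set (borel M))
          (EFin \o fun x => \sum_(k < N) Xder (X k) v x * Xder (X k) G x) ->
        (\int[nu]_(x in (Omega : set (borel M)))
           (\sum_(k < N) Xder (X k) v x * Xder (X k) G x)%:E
         - (\1_Omega y * v y)%:E
         = (\sum_(k < N) single_flux S k (fun x => v x * Xder (X k) G x))%:E)%E].

(** The boundary functional [C(u)]. *)
Definition Cbdry (S : patches R n M) (Omega : set M) (G : M -> R)
    (alpha beta : R) (u : M -> R) : R :=
  (alpha - 2) / (2 - beta) *
    flux S (fun x => u x ^+ 2 * G x `^ ((alpha - 2) / (2 - beta) - 1))
      (fun k => Xder (X k) G)
  - 2 * flux S (fun x => G x `^ ((alpha - 2) / (2 - beta)) * u x)
      (fun k => bvalue Omega (Xder (X k) u)).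

End Domains.

(* Main.v *)
Require Import Defs.
From HB Require Import structures.
From mathcomp Require Import all_boot all_order all_algebra.
From mathcomp Require Import all_classical all_reals all_analysis.
From mathcomp Require Import measurable_realfun lra ring.
Import Order.TTheory GRing.Theory Num.Theory.
Import numFieldNormedType.Exports.

Set Implicit Arguments.
Unset Strict Implicit.
Unset Printing Implicit Defensive.

Local Open Scope classical_set_scope.
Local Open Scope ring_scope.

(** Write [e = (beta + alpha - 4) / (beta - 2) > 0], so that the weights of the
    theorem are powers of [G]: up to constants, [G^(1-e)] in front of
    [|grad u|^2] and [G^(-e-1) |grad G|^2] in front of [u^2].

    Strong admissibility turns the flux of [v grad G] into the integral of
    [<grad v, grad G>] whenever [v] vanishes near the pole [y].  It is applied to
    [v = F(G) u^2] cut off where [G] is large; the cutoff is removed by dominated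
    convergence, because [G^(-e-1) |grad G|^2] is integrable, which is the case
    [F = G^(-e)], [u = 1] of the same identity, where all terms have one sign.
    Integrating the square of [grad u + (a/2 + s / log) u (grad d)/d], with
    [a = beta + alpha - 4], then gives a Hardy inequality with explicit boundary
    terms ([s = 0] without and [s = 1/2] with the logarithmic remainder).

    The divergence formula for [G^(1-e) u grad u] expresses the integral of
    [G^(1-e) |grad u|^2] by that of [- G^(1-e) u (L u)], and the Cauchy-Schwarz
    inequality bounds the latter by the left-hand side of the theorem; when this
    left-hand side is finite, it also provides the missing integrability.

    All divergence formulas are about the fluxes of the single fields [X_k];
    adding them up requires the pullbacks of [<X_k, dnu>] to be continuous on the
    cube, hence independent of the chart. *)

(** * Limits and differentials *)

Section Limits.
Context {T : Type} {F : set_system T} {FF : ProperFilter F}.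

Lemma cvg_near_eq (U : topologicalType) (f g : T -> U) (l : U) :
  (\forall z \near F, f z = g z) -> g @ F --> l -> f @ F --> l.
Proof.
move=> fg; apply: cvg_trans; apply: near_eq_cvg.
by apply: filterS fg => z ->.
Qed.

Lemma cvg_sumr (R : numFieldType) (V : normedModType R) (I : Type) (r : seq I)
    (f : I -> T -> V) (a : I -> V) :
  (forall i, f i @ F --> a i) -> (fun z => \sum_(i <- r) f i z) @ F --> \sum_(i <- r) a i.
Proof.
move=> fa; elim: r => [|i r IH].
  by rewrite big_nil; under eq_fun do rewrite big_nil; exact: cvg_cst.
by rewrite big_cons; under eq_fun do rewrite big_cons; exact: cvgD.
Qed.

Lemma cvg_prodr (R : numFieldType) (I : Type) (r : seq I) (f : I -> T -> R) (a : I -> R) :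
  (forall i, f i @ F --> a i) -> (fun z => \prod_(i <- r) f i z) @ F --> \prod_(i <- r) a i.
Proof.
move=> fa; elim: r => [|i r IH].
  by rewrite big_nil; under eq_fun do rewrite big_nil; exact: cvg_cst.
by rewrite big_cons; under eq_fun do rewrite big_cons; exact: cvgM.
Qed.

Lemma cvg_det (R : numFieldType) n (B : T -> 'M[R]_n) (C : 'M[R]_n) :
  (forall i j, (fun z => B z i j) @ F --> C i j) -> (fun z => \det (B z)) @ F --> \det C.
Proof.
move=> BC; apply: cvg_sumr => s; apply: cvgM; first exact: cvg_cst.
by apply: cvg_prodr => i; exact: BC.
Qed.

Lemma cvg_mx (U : topologicalType) m n (B : T -> 'M[U]_(m, n)) (C : 'M[U]_(m, n)) :
  (forall i j, (fun z => B z i j) @ F --> C i j) -> B @ F --> C.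
Proof.
move=> BC Q [P CP PQ]; rewrite /= in PQ.
have : \forall z \near F, forall i j, P i j (B z i j).
  apply: filter_forall => i; apply: filter_forall => j; exact: BC (CP i j).
by apply: filterS => z Pz; apply: PQ.
Qed.
End Limits.

Section Transitions.
Variable R : realType.

(* When [f] is not differentiable, ['d f x] is the zero map. *)
Lemma diff_neq0_differentiable (n m : nat) (f : 'rV[R]_n -> 'rV[R]_m) x :
  'd f x <> (fun=> 0) :> (_ -> _) -> differentiable f x.
Proof.
move=> h.
pose P := fun df : {linear 'rV[R]_n -> 'rV[R]_m} => continuous df /\
  (forall x0, f x0 = f (lim (nbhs x)) + df (x0 - lim (nbhs x))
     +o_(x0 \near x) (x0 - lim (nbhs x))).
have dE : 'd f x = xget point P by rewrite /diff.
have [H|H] := pselect (P (xget point P)); first by apply/diffP; rewrite dE.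
exfalso; apply: h; rewrite dE xgetPN; first exact/funext.
by move=> df hdf; apply: H; exact: (xgetI _ hdf).
Qed.

Lemma diff_jacobian (n m : nat) (f : 'rV[R]_n -> 'rV[R]_m) x v :
  'd f x v = v *m jacobian f x.
Proof. by rewrite mul_rV_lin1. Qed.

Lemma derive_line (V W : normedModType R) (f : V -> W) t v :
  'D_v f t = 'D_1 (fun r : R => f (r *: v + t)) 0.
Proof.
rewrite /derive; congr (lim (_ @ 0^')); apply/funext => h /=.
by rewrite addr0 scale0r add0r /GRing.scale/= mulr1.
Qed.

Lemma derive1_compl (n m : nat) (k : R -> 'rV[R]_n)
  (g : 'rV[R]_n -> 'rV[R]_m) r :
  derivable k r 1 -> differentiable g (k r) ->
  derivable (g \o k) r 1 /\ 'D_1 (g \o k) r = 'd g (k r) ('D_1 k r).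
Proof.
move=> /derivable1_diffP kd gd; have cd := differentiable_comp kd gd.
split; first exact/derivable1_diffP.
have -> : 'D_1 k r = 'd k r 1 by exact: deriveE.
have -> : 'D_1 (g \o k) r = 'd (g \o k) r 1 by exact: deriveE.
have -> : 'd (g \o k) r = 'd g (k r) \o 'd k r :> (_ -> _) by exact: diff_comp.
by [].
Qed.

(** Only a directional derivative of [f] is at hand, so the chain rule is applied on the line
    through [t] with direction [v]. *)
Lemma derive_comp (V : normedModType R) (n m : nat) (f : V -> 'rV[R]_n)
  (g : 'rV[R]_n -> 'rV[R]_m) t v :
  derivable f t v -> differentiable g (f t) ->
  derivable (g \o f) t v /\ 'D_v (g \o f) t = 'd g (f t) ('D_v f t).
Proof.
move=> /derivable1P fd gd.
pose k := fun r : R => f (r *: v + t).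
have k0 : k 0 = f t by rewrite /k scale0r add0r.
rewrite -k0 in gd *.
have [d1 d2] := derive1_compl fd gd.
split; first exact/derivable1P.
by rewrite (derive_line (g \o f)) (derive_line f) -d2.
Qed.

End Transitions.
(** * Fluxes *)

Section Pullback.
Variables (R : realType) (n' : nat) (M : ptopologicalType).
Let n := n'.+1.
Variables (A : manifold R n M) (w : volume_form A).

(** Smoothness of a change of chart is stated by partial derivatives; the total differential comes
    from the volume form. Its nonvanishing coefficients force a nonzero Jacobian determinant,
    whereas a non-differentiable map would have the zero map as differential, with zero determinant
    in positive dimension. *)
Lemma transition_differentiable (i j : chart A) x : dom i x -> dom j x ->
  differentiable (crd j \o par i) (crd i x).
Proof.
move=> ix jx; apply: diff_neq0_differentiable => d0.
have := vol_neq0 w ix; rewrite (volE w ix jx) mulf_eq0 negb_or => /andP[_].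
rewrite (_ : jacobian _ _ = 0) ?det0 ?eqxx//.
apply/row_matrixP => k; rewrite rowE -diff_jacobian row0.
by rewrite d0.
Qed.

(** The contraction read in an arbitrary chart instead of [chart_at (s t)]. *)
Definition chart_pullback (i : chart A) (Y : M -> 'rV[R]_n)
    (s : 'rV[R]_n' -> M) (t : 'rV[R]_n') : R :=
  w i (s t) * \det (\matrix_(r < n)
    (if r == 0%N :> nat then Y (s t)
     else 'D_(\row_(k < n') (k.+1 == r :> nat)%:R) (crd i \o s) t)).

Lemma row_delta (r : 'I_n) : r != 0%N :> nat ->
  exists k : 'I_n', (\row_(k < n') (k.+1 == r :> nat)%:R : 'rV[R]_n') = delta_mx 0 k.
Proof.
case: r => [[//|r] rn] _ /=; rewrite /n ltnS in rn; exists (Ordinal rn).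
by apply/rowP => k; rewrite !mxE eqxx eqSS.
Qed.

Lemma rows_mul m p q (F : 'I_m -> 'rV[R]_p) (B : 'M[R]_(p, q)) :
  (\matrix_(r < m) F r) *m B = \matrix_(r < m) (F r *m B).
Proof. by apply/row_matrixP => r; rewrite row_mul !rowK. Qed.

(** A change of chart multiplies every row on the right by the Jacobian, and the coefficient of the
    volume form changes by exactly its determinant. *)
Lemma chart_pullbackE (i j : chart A) (V : vector_field A) s t :
  dom i (s t) -> dom j (s t) -> {for t, continuous s} ->
  (forall k, derivable (crd i \o s) t (delta_mx 0 k)) ->
  chart_pullback i (V i) s t = chart_pullback j (V j) s t.
Proof.
move=> ix jx sc sd; rewrite /chart_pullback (volE w ix jx) -mulrA; congr (_ * _).
rewrite mulrC -det_mulmx rows_mul; congr (\det _); apply/row_matrixP => r.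
rewrite !rowK; case: ifPn => [_|r0].
  by rewrite (vfE V ix jx); exact: esym (diff_jacobian _ _ _).
apply: (etrans (esym (diff_jacobian _ _ _))).
have [k ->] := row_delta r0.
have dif := transition_differentiable ix jx.
have [_ <-] := derive_comp (sd k) dif.
apply: near_eq_derive.
have : \forall z \near t, dom i (s z) by apply: sc; exact: open_nbhs_nbhs (conj (dom_open i) ix).
by apply: filterS => z iz /=; rewrite crdK.
Qed.

Lemma contraction_pullbackE (i : chart A) (V : vector_field A) s t :
  dom i (s t) -> {for t, continuous s} ->
  (forall k, derivable (crd i \o s) t (delta_mx 0 k)) ->
  contraction_pullback w V s t = chart_pullback i (V i) s t.
Proof.
by move=> ix sc sd; rewrite (chart_pullbackE V ix (chart_atP A (s t)) sc sd).
Qed.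

(** Expansion along the first row, the only one that contains [Y]: the cofactors do not see [Y], so
    they can be computed with the zero field. *)
Lemma contraction_pullback_lin s t : exists c : 'I_n -> R,
  forall Y, contraction_pullback w Y s t =
    \sum_(l < n) Y (chart_at A (s t)) (s t) 0 l * c l.
Proof.
pose B Y := (\matrix_(r < n)
    (if r == 0%N :> nat then Y (chart_at A (s t)) (s t)
     else 'D_(\row_(k < n') (k.+1 == r :> nat)%:R) (crd (chart_at A (s t)) \o s) t)).
exists (fun l => w (chart_at A (s t)) (s t) * cofactor (B (fun _ _ => 0)) ord0 l) => Y.
rewrite [LHS](_ : _ = w (chart_at A (s t)) (s t) * \det (B Y))//.
rewrite (expand_det_row _ ord0) mulr_sumr; apply: eq_bigr => l _.
rewrite mxE eqxx mulrCA; congr (_ * (_ * _)).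
rewrite /cofactor; congr (_ * \det _); apply/matrixP => a b; rewrite !mxE.
by rewrite !lift0.
Qed.

Lemma contraction_pullbackZ (f : M -> R) (Y : chart A -> M -> 'rV[R]_n) s t :
  contraction_pullback w (fun i x => f x *: Y i x) s t
  = f (s t) * contraction_pullback w Y s t.
Proof.
have [c cE] := contraction_pullback_lin s t; rewrite !cE mulr_sumr.
by apply: eq_bigr => l _; rewrite mxE mulrA.
Qed.

Lemma contraction_pullback_sum (I : finType) (Y : I -> chart A -> M -> 'rV[R]_n) s t :
  contraction_pullback w (fun i x => \sum_k Y k i x) s t
  = \sum_k contraction_pullback w (Y k) s t.
Proof.
have [c cE] := contraction_pullback_lin s t; rewrite !cE.
under [RHS]eq_bigr do rewrite cE.
rewrite exchange_big/=; apply: eq_bigr => l _.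
by rewrite summxE mulr_suml.
Qed.

Lemma chart_near (i : chart A) (x : M) : dom i x -> \forall z \near x, dom i z.
Proof. by move=> ix; apply: open_nbhs_nbhs; split => //; exact: dom_open. Qed.

(** The chart [chart_at A (s t)] may jump along the patch. By chart independence one fixed chart [i]
    serves in a whole neighbourhood of [t], and there every factor is continuous. *)
Lemma contraction_pullback_continuous (V : vector_field A) (s : 'rV[R]_n' -> M)
    (W : set 'rV[R]_n') t :
  open W -> (forall z, W z -> {for z, continuous s}) ->
  (forall i : chart A, Ck 1 (W `&` s @^-1` dom i) (crd i \o s)) -> W t ->
  {for t, continuous (contraction_pullback w V s)}.
Proof.
move=> oW sc sd Wt; pose i := chart_at A (s t).
have ix : dom i (s t) by exact: chart_atP.
have nearW : \forall z \near t, (W `&` s @^-1` dom i) z.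
  near=> z; split; near: z; first exact: open_nbhs_nbhs.
  exact: (sc _ Wt _ (chart_near ix)).
have der z : (W `&` s @^-1` dom i) z ->
    forall k, derivable (crd i \o s) z (delta_mx 0 k).
  by move=> Wz k; have [_ /(_ k)[/(_ _ Wz)]] := sd i.
have crds : (crd i \o s) @ t --> crd i (s t).
  have [h _] := sd i; exact: (h t (conj Wt ix)).
have comp_cvg (U : topologicalType) (g : M -> U) :
    {for crd i (s t), continuous (g \o par i)} -> (g \o s) @ t --> g (s t).
  move=> gc; rewrite -[s t in X in _ --> X](crdK ix).
  apply: (cvg_near_eq (F := nbhs t) (g := (g \o par i) \o (crd i \o s))).
    by apply: filterS nearW => z [_ iz] /=; rewrite crdK.
  have H := @continuous_comp _ _ _ (crd i \o s) (g \o par i) t crds gc; exact: H.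
have im : (crd i @` dom i) (crd i (s t)) by exists (s t).
rewrite /prop_for /continuous_at (contraction_pullbackE V ix (sc _ Wt) (der _ (conj Wt ix))).
apply: (cvg_near_eq (F := nbhs t) (g := chart_pullback i (V i) s)).
  apply: filterS nearW => z Wz; apply: contraction_pullbackE.
  - exact: Wz.2.
  - exact: sc Wz.1.
  - exact: der.
apply: cvgM.
  apply: comp_cvg; have [/(_ _ im) h _] := vol_smooth w i 0%N; exact: h.
apply: cvg_det => r l; rewrite mxE; under eq_fun do rewrite mxE.
case: ifPn => r0.
  have [/(_ _ im) h _] := vf_smooth V i 0%N.
  apply: (@cvg_comp _ _ _ (V i \o s) (fun v : 'rV[R]_n => v 0 l)).
    exact: comp_cvg h.
  exact: coord_continuous.
have [k ->] := row_delta r0.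
apply: (@cvg_comp _ _ _ (fun z => 'D_(delta_mx 0 k) (crd i \o s) z) (fun v : 'rV[R]_n => v 0 l)).
  by have [_ /(_ k)[_ [h _]]] := sd i; exact: h.
exact: coord_continuous.
Unshelve. all: by end_near. Qed.

End Pullback.

(** * Iterated integrals of continuous functions over the cube *)

Section IteratedIntegral.
Variable R : realType.

Definition cons_row m (t : R) (v : 'rV[R]_m) : 'rV[R]_m.+1 := @row_mx R 1 1 m t%:M v.

Lemma cons_row_continuous m (X : topologicalType) (f : X -> R)
    (g : X -> 'rV[R]_m) x :
  {for x, continuous f} -> {for x, continuous g} ->
  {for x, continuous (fun z => cons_row (f z) (g z))}.
Proof.
move=> fa gb; set a := f x; set b := g x; apply: (@cvg_mx _ _ _ R^o 1 m.+1) => i j.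
case: (split_ordP (j : 'I_(1 + m))) => k ->.
  rewrite [X in _ --> X](_ : _ = a); last first.
    by rewrite -[LHS]/((row_mx a%:M b : 'rV[R]_(1 + m)) i _) row_mxEl mxE !ord1 eqxx mulr1n.
  apply: (cvg_near_eq _ fa); apply: nearW => z.
  by rewrite -[LHS]/((row_mx (f z)%:M (g z) : 'rV[R]_(1 + m)) i _) row_mxEl mxE !ord1 eqxx mulr1n.
rewrite [X in _ --> X](_ : _ = b i k); last first.
  by rewrite -[LHS]/((row_mx a%:M b : 'rV[R]_(1 + m)) i _) row_mxEr.
apply: (@cvg_near_eq _ _ _ _ _ (fun z => g z i k)).
  apply: nearW => z.
  by rewrite -[LHS]/((row_mx (f z)%:M (g z) : 'rV[R]_(1 + m)) i _) row_mxEr.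
apply: (@cvg_comp _ _ _ g (fun v : 'rV[R]_m => v i k)); first exact: gb.
exact: coord_continuous.
Qed.

Lemma cons_row_cube m (t : R) (v : 'rV[R]_m) : 0 <= t <= 1 -> cube v ->
  cube (cons_row t v).
Proof.
move=> t01 cv j; change (0 <= (row_mx t%:M v : 'rV[R]_(1 + m)) 0 j <= 1).
case: (split_ordP (j : 'I_(1 + m))) => k ->; last by rewrite row_mxEr.
by rewrite row_mxEl mxE !ord1 eqxx mulr1n.
Qed.

Lemma eq_iterint m (f g : 'rV[R]_m -> \bar R) : (forall t, cube t -> f t = g t) ->
  iterint `[0, 1] f = iterint `[0, 1] g.
Proof.
elim: m f g => [|m IH] f g fg /=; first by apply: fg => -[].
apply: eq_integral => t; rewrite inE/= in_itv/= => t01.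
by apply: IH => v cv; apply: fg; exact: cons_row_cube.
Qed.

Lemma compact_cube m : compact (@cube R m).
Proof.
have := @rV_compact R m (fun=> `[0, 1]%classic) (fun=> @segment_compact _ _ _).
rewrite (_ : [set v | _] = cube)//.
Qed.

Let I01 : set R := `[0, 1]%classic.

(** The three claims need a common induction: additivity and the bound for slices show that the
    inner integral [F f] is continuous in the outer variable, hence integrable on the segment, and
    this gives all three claims one dimension higher. *)
Lemma iterint_continuous m :
  [/\ forall f : 'rV[R]_m -> R, continuous f -> iterint I01 (EFin \o f) \is a fin_num,
      forall f g : 'rV[R]_m -> R, continuous f -> continuous g ->
        iterint I01 (EFin \o (f \+ g)) =
        (iterint I01 (EFin \o f) + iterint I01 (EFin \o g))%E &
      forall (f : 'rV[R]_m -> R) (C : R), continuous f -> (forall t, cube t -> `|f t| <= C) ->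
        (`|iterint I01 (EFin \o f)| <= C%:E)%E].
Proof.
elim: m => [|m [fin add bnd]].
  split=> //= f C _; rewrite lee_fin; apply; by case.
pose F (f : 'rV[R]_m.+1 -> R) t := fine (iterint I01 (fun v : 'rV[R]_m => (f (cons_row t v))%:E)).
have slicec (f : 'rV[R]_m.+1 -> R) t : continuous f -> continuous (fun v : 'rV[R]_m => f (cons_row t v)).
  move=> fc v; have H := @continuous_comp _ _ _ (fun v => cons_row t v) f v; apply: H; last exact: fc.
  by apply: cons_row_continuous; [exact: cst_continuous|by move=> B].
have FE (f : 'rV[R]_m.+1 -> R) t : continuous f ->
    iterint I01 (fun v : 'rV[R]_m => (f (cons_row t v))%:E) = (F f t)%:E.
  by move=> fc; rewrite fineK//; apply: fin; exact: slicec.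
have Fadd (f g : 'rV[R]_m.+1 -> R) t : continuous f -> continuous g -> F (f \+ g) t = F f t + F g t.
  move=> fc gc; apply: EFin_inj; rewrite EFinD -!FE//; last first.
    by move=> x; exact: (cvgD (fc x) (gc x)).
  by apply: add; exact: slicec.
have Fbnd (f : 'rV[R]_m.+1 -> R) C t : continuous f -> 0 <= t <= 1 -> (forall t, cube t -> `|f t| <= C) -> `|F f t| <= C.
  move=> fc t01 fC; rewrite -lee_fin -abse_EFin -FE//; apply: bnd; first exact: slicec.
  by move=> v cv; apply: fC; exact: cons_row_cube.
have Fc (f : 'rV[R]_m.+1 -> R) : continuous f -> continuous (F f).
  move=> fc t0; apply/cvgrPdist_le => e e0.
  (* Compactness of the cube makes the closeness of the slices at [t] and [t0] uniform in the
     remaining coordinates. *)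
  have /compact_near_coveringP nc := @compact_cube m.
  have {}nc := nc R (nbhs t0) (fun t v => `|f (cons_row t v) - f (cons_row t0 v)| <= e) _.
  have : forall v, cube v -> \forall v' \near v & t \near nbhs t0,
      `|f (cons_row t v') - f (cons_row t0 v')| <= e.
    move=> v cv.
    pose h (p : 'rV[R]_m * R) := f (cons_row p.2 p.1) - f (cons_row t0 p.1).
    have : h @ (v, t0) --> h (v, t0).
      apply: cvgB.
        have H := @continuous_comp _ _ _ (fun p : 'rV[R]_m * R => cons_row p.2 p.1) f (v, t0); apply: H; last exact: fc.
        by apply: cons_row_continuous; [exact: cvg_snd|exact: cvg_fst].
      have H := @continuous_comp _ _ _ (fun p : 'rV[R]_m * R => cons_row t0 p.1) f (v, t0); apply: H; last exact: fc.
      by apply: cons_row_continuous; [exact: cst_continuous|exact: cvg_fst].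
    move=> /cvgrPdist_le/(_ _ e0).
    rewrite /h/= subrr; apply: filterS => p; by rewrite sub0r normrN.
  move=> /nc; apply: filterS => t tP.
  pose g v := f (cons_row t v) - f (cons_row t0 v).
  have gc : continuous g by move=> v; exact: (cvgB (slicec f t fc v) (slicec f t0 fc v)).
  have : (`|iterint I01 (EFin \o g)| <= e%:E)%E by apply: bnd.
  have -> : iterint I01 (EFin \o g) = (F f t - F f t0)%:E.
    apply/eqP; rewrite EFinB eq_sym sube_eq// ?fin_num_adde_defl//; apply/eqP.
    rewrite -!FE// -add//; last exact: slicec.
    by apply: eq_iterint => v _ /=; rewrite /g subrK.
  by rewrite abse_EFin lee_fin distrC.
have Fi (f : 'rV[R]_m.+1 -> R) : continuous f -> lebesgue_measure.-integrable `[0, 1] (EFin \o F f).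
  move=> fc; apply: continuous_compact_integrable; first exact: segment_compact.
  by apply: continuous_subspaceT; exact: Fc.
have iE (f : 'rV[R]_m.+1 -> R) : continuous f -> iterint I01 (EFin \o f) = (\int[lebesgue_measure]_(t in `[0, 1]) F f t)%:E.
  move=> fc /=; rewrite fineK; last by apply: integrable_fin_num => //; exact: Fi.
  by apply: eq_integral => t _; rewrite FE.
split.
- by move=> f fc; rewrite iE.
- move=> f g fc gc; rewrite !iE//; last first.
    by move=> x; exact: (cvgD (fc x) (gc x)).
  rewrite -EFinD -RintegralD//; [|exact: Fi..].
  by under eq_Rintegral do rewrite Fadd//.
- move=> f C fc fC; rewrite iE// abse_EFin lee_fin.
  have mI : measurable (`[0, 1]%classic : set (measurableTypeR R)) by exact: measurable_itv.
  have H := le_normr_Rintegral mI (Fi f fc); apply: (le_trans H).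
  have -> : C = \int[lebesgue_measure]_(t in `[0, 1]) (cst C t).
    by rewrite Rintegral_cst//= lebesgue_measure_itv/= lte_fin ltr01 oppr0 adde0 mulr1.
  apply: le_Rintegral => //.
  - exact: (integrable_norm (Fi _ fc)).
  - by apply: continuous_compact_integrable; [exact: segment_compact|apply: continuous_subspaceT => x; exact: cvg_cst].
  - by move=> t; rewrite /= in_itv/= => t01; exact: Fbnd.
Qed.

End IteratedIntegral.

Section IterintSum.
Variable R : realType.
Let I01 : set R := `[0, 1]%classic.

(** Retraction of the whole space onto the cube: composing with it makes a function that is
    continuous only on the cube continuous everywhere, without changing its integral over the
    cube. *)
Definition clamp m (v : 'rV[R]_m) : 'rV[R]_m := \row_j Num.max 0 (Num.min 1 (v 0 j)).

Lemma clamp_cube m (v : 'rV[R]_m) : cube (clamp v).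
Proof.
by move=> j; rewrite mxE le_max lexx/= ge_max ler01/= ge_min lexx.
Qed.

Lemma clamp_id m (v : 'rV[R]_m) : cube v -> clamp v = v.
Proof.
move=> cv; apply/rowP => j; rewrite mxE; have /andP[v0 v1] := cv j.
by rewrite (min_idPr v1) (max_idPr v0).
Qed.

Lemma clamp_continuous m : continuous (@clamp m).
Proof.
move=> v; apply: (cvg_mx (F := nbhs v)) => i j; rewrite ord1.
have -> : (fun z : 'rV[R]_m => clamp z 0 j) = (fun z => Num.max 0 (Num.min 1 (z 0 j))).
  by apply/funext => z; rewrite mxE.
rewrite mxE; pose co (z : 'rV[R]_m) : R^o := z 0 j.
have cc : {for v, continuous co} by exact: coord_continuous.
have kc (c : R^o) : {for v, continuous (cst c : 'rV[R]_m -> R^o)} by exact: cst_continuous.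
exact: (continuous_max (kc 0) (continuous_min (kc 1) cc)).
Qed.

Lemma comp_clamp_continuous m (f : 'rV[R]_m -> R) :
  {within cube, continuous f} -> continuous (f \o @clamp m).
Proof.
move=> /subspace_continuousP fc v; apply: cvg_comp (fc _ (clamp_cube v)).
move=> B cB; have h : nbhs v (@clamp m @^-1` [set z | cube z -> B z]) := clamp_continuous cB.
by apply: filterS h => z; apply; exact: clamp_cube.
Qed.

Lemma iterint_sum m (I : Type) (r : seq I) (q : I -> 'rV[R]_m -> R) :
  (forall k, {within cube, continuous (q k)}) ->
  fine (iterint I01 (fun t => (\sum_(k <- r) q k t)%:E)) =
  \sum_(k <- r) fine (iterint I01 (EFin \o q k)).
Proof.
move=> qc; have [fin add bnd] := iterint_continuous R m.
have qcc k := comp_clamp_continuous (qc k).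
have qE (f : 'rV[R]_m -> R) : iterint I01 (EFin \o f) = iterint I01 (EFin \o (f \o @clamp m)).
  by apply: eq_iterint => t ct /=; rewrite clamp_id.
rewrite (qE (fun t => \sum_(k <- r) q k t)).
suff : continuous (fun t => \sum_(k <- r) q k (clamp t)) /\
    fine (iterint I01 (EFin \o (fun t => \sum_(k <- r) q k (clamp t)))) =
    \sum_(k <- r) fine (iterint I01 (EFin \o q k)) by case.
elim: r => [|k r [IHc IH]].
  have c0 : continuous (cst 0 : 'rV[R]_m -> R) by exact: cst_continuous.
  have -> : (fun t => \sum_(k <- [::]) q k (clamp t)) = cst 0.
    by apply/funext => t; rewrite big_nil.
  split=> //; rewrite big_nil.
  apply: EFin_inj; rewrite fineK; last exact: fin.
  apply/eqP; rewrite -abse_eq0 eq_le abse_ge0 andbT; apply: bnd => // t _ /=.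
  by rewrite normr0.
have -> : (fun t => \sum_(k0 <- (k :: r)) q k0 (clamp t)) =
    (q k \o @clamp m) \+ (fun t => \sum_(k <- r) q k (clamp t)).
  by apply/funext => t; rewrite big_cons.
split; first by move=> t; exact: (cvgD (qcc k t) (IHc t)).
by rewrite add// fineD ?fin// IH big_cons -qE.
Qed.
End IterintSum.

Section Flux.
Variables (R : realType) (n' : nat) (M : ptopologicalType).
Let n := n'.+1.
Variables (A : manifold R n M) (w : volume_form A).
Variables (N : nat) (X : 'I_N -> vector_field A).
Variables (S : patches R n M) (Omega : set M).
Hypothesis hS : presents A S (closure Omega `\` Omega).

Lemma patch_boundary j t : cube t -> (closure Omega `\` Omega) (Defs.patch S j t).
Proof. by case: hS => _ _ -> _ ct; exists j => //; exists t. Qed.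

(** Patches map the cube into the boundary and the pullback is linear in the field, so a flux
    depends only on the boundary values of the products [f * p k]. This later removes cutoffs from
    fluxes and replaces [bvalue] by a continuous extension. *)
Lemma eq_flux (f f' : M -> R) (p p' : 'I_N -> M -> R) :
  (forall x k, (closure Omega `\` Omega) x -> f x * p k x = f' x * p' k x) ->
  flux w X S f p = flux w X S f' p'.
Proof.
move=> fp; apply: eq_bigr => j _; congr (_ * fine _); apply: eq_iterint => t ct.
rewrite !contraction_pullbackZ /hfield !contraction_pullback_sum !mulr_sumr.
congr EFin; apply: eq_bigr => k _.
by rewrite !contraction_pullbackZ !mulrA fp//; exact: patch_boundary.
Qed.

(** The pullback is a sum over [k]; the integral may be split because each summand is continuous on
    the cube, by continuity of [f * p k] on the closure and of the pullback of [X k]. *)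
Lemma fluxE (f : M -> R) (p : 'I_N -> M -> R) :
  (forall k, {within closure Omega, continuous (fun x => f x * p k x)}) ->
  flux w X S f p = \sum_(k < N) single_flux w X S k (fun x => f x * p k x).
Proof.
move=> fpc; rewrite /single_flux /surface_integral exchange_big/=.
apply: eq_bigr => j _; rewrite -mulr_sumr; congr (_ * _).
pose q k t := f (Defs.patch S j t) * p k (Defs.patch S j t) * contraction_pullback w (X k) (Defs.patch S j) t.
rewrite (@eq_iterint R _ _ (fun t => (\sum_(k < N) q k t)%:E)); last first.
  move=> t ct; rewrite contraction_pullbackZ /hfield contraction_pullback_sum mulr_sumr.
  by congr EFin; apply: eq_bigr => k _; rewrite contraction_pullbackZ mulrA.
rewrite iterint_sum; last first.
  move=> k; have [/(_ j)[W [oW cW sc sd]] _ _ _] := hS.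
  apply/subspace_continuousP => t ct.
  have c1 := @contraction_pullback_continuous R n' M A w (X k) _ _ _ oW sc sd (cW _ ct).
  have c1' : contraction_pullback w (X k) (Defs.patch S j) @ within cube (nbhs t) -->
      contraction_pullback w (X k) (Defs.patch S j) t by exact: cvg_within_filter.
  have c2 : (fun t => f (Defs.patch S j t) * p k (Defs.patch S j t)) @ within cube (nbhs t)
      --> f (Defs.patch S j t) * p k (Defs.patch S j t).
    have /subspace_continuousP/(_ (Defs.patch S j t) (patch_boundary j ct).1) := fpc k.
    apply: cvg_comp => B; rewrite /within/= => hB.
    have h : nbhs t (Defs.patch S j @^-1` [set x | closure Omega x -> B x]).
      exact: (sc _ (cW _ ct) _ hB).
    by apply: filterS h => z h cz; apply: h; exact: (patch_boundary j cz).1.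
  exact: (cvgM c2 c1').
apply: eq_bigr => k _; congr fine; apply: eq_iterint => t ct /=.
by rewrite contraction_pullbackZ.
Qed.
End Flux.

(** * Derivatives along vector fields *)

Section DirectionalDerivatives.
Variables (R : realType) (n : nat) (M : ptopologicalType) (A : manifold R n M).

Section OneField.
Variable V : vector_field A.

(** [is_Xder] includes the existence of an integral curve, and the derivative along that single
    curve already determines the value. *)
Lemma XderE u x l : is_Xder V u x l -> Xder V u x = l.
Proof.
move=> ul; apply: xget_unique => // l' [[c cx] h'].
have [_ h] := ul.
by have [_ <-] := h' _ cx; have [_ <-] := h _ cx.
Qed.

Lemma XderP u x : Xderivable V u x -> is_Xder V u x (Xder V u x).
Proof. by move=> [l ul]; rewrite (XderE ul). Qed.

Lemma integral_curve_continuous (x : M) c : integral_curve V x c -> c @ (0 : R) --> x.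
Proof. by move=> [<- /nbhs_singleton []]. Qed.

Lemma near_eq_is_Xder u v (x : M) l : (\forall z \near x, u z = v z) ->
  is_Xder V u x l -> is_Xder V v x l.
Proof.
move=> uv [cex ul]; split=> // c cx.
have h : \forall t \near (0 : R^o), (u \o c : R^o -> R^o) t = (v \o c : R^o -> R^o) t.
  exact: (integral_curve_continuous cx uv).
exact: (near_eq_is_derive h (ul c cx)).
Qed.

Lemma near_eq_Xder u v (x : M) : (\forall z \near x, u z = v z) -> Xder V u x = Xder V v x.
Proof.
move=> uv; rewrite /Xder; congr (xget 0 _); apply/seteqP; split=> l /=.
  exact: near_eq_is_Xder.
by apply: near_eq_is_Xder; apply: filterS uv => z ->.
Qed.

Lemma near_eq_Xder_near u v (x : M) : (\forall z \near x, u z = v z) ->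
  \forall z \near x, Xder V u z = Xder V v z.
Proof. by move=> /near_join; apply: filterS => z; exact: near_eq_Xder. Qed.

Lemma is_Xder_comp (u : M -> R) (x : M) l (phi : R -> R) a :
  is_derive (u x : R^o) 1 (phi : R^o -> R^o) a -> is_Xder V u x l -> is_Xder V (phi \o u) x (a * l).
Proof.
move=> phia [cex ul]; split=> // c cx; have H := ul c cx.
have c0 : c 0 = x by case: cx.
rewrite -c0 in phia.
exact: (@is_derive1_comp R phi (u \o c) 0 a l phia H).
Qed.

Lemma is_XderM u v x a b : is_Xder V u x a -> is_Xder V v x b ->
  is_Xder V (fun z => u z * v z) x (u x * b + v x * a).
Proof.
move=> [cex ul] [_ vl]; split=> // c cx; have H := ul c cx; have H' := vl c cx.
have c0 : c 0 = x by case: cx.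
by have := is_deriveM H H'; rewrite /= c0.
Qed.

Lemma is_Xder_cst u x l k : is_Xder V u x l -> is_Xder V (fun=> k) x 0.
Proof.
move=> [cex _]; split=> // c cx; exact: is_derive_cst.
Qed.

(** If no integral curve starts at [x], the default value of [Xder] is 0 as well. *)
Lemma Xder_cst k x : Xder V (fun=> k) x = 0.
Proof.
have [[l kl]|nder] := pselect (exists l, is_Xder V (fun=> k) x l).
  exact: XderE (is_Xder_cst k kl).
by rewrite /Xder xgetPN// => l kl; apply: nder; exists l.
Qed.
End OneField.

Variables (N : nat) (X : 'I_N -> vector_field A).

Lemma C1X_comp (U : set M) (u : M -> R) (phi dphi : R -> R) : open U -> C1X X U u ->
  (forall x, U x -> is_derive (u x : R^o) 1 (phi : R^o -> R^o) (dphi (u x))) ->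
  (forall x, U x -> {for u x, continuous dphi}) ->
  C1X X U (phi \o u) /\
  forall k x, U x -> is_Xder (X k) (phi \o u) x (dphi (u x) * Xder (X k) u x).
Proof.
move=> oU [uc ud] phid dphic.
have isd k x : U x -> is_Xder (X k) (phi \o u) x (dphi (u x) * Xder (X k) u x).
  by move=> Ux; apply: is_Xder_comp; [exact: phid|apply: XderP; exact: (ud k x Ux).1].
split=> //; split=> [x Ux|k x Ux].
  apply: continuous_comp; first exact: uc.
  apply: differentiable_continuous; apply/derivable1_diffP.
  by have [] := phid _ Ux.
split; first by eexists; exact: isd.
have H : {for x, continuous (fun z => dphi (u z) * Xder (X k) u z)}.
  apply: cvgM; last exact: (ud k x Ux).2.
  have H := @continuous_comp _ _ _ u dphi x (uc _ Ux) (dphic _ Ux); exact: H.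
rewrite /prop_for /continuous_at (XderE (isd k x Ux)).
apply: (cvg_near_eq _ H).
have nU : \forall z \near x, U z by exact: open_nbhs_nbhs.
by apply: filterS nU => z Uz; exact: XderE (isd k z Uz).
Qed.

Lemma C1X_mul (U : set M) u v : open U -> C1X X U u -> C1X X U v ->
  C1X X U (fun z => u z * v z) /\
  forall k x, U x -> is_Xder (X k) (fun z => u z * v z) x
    (u x * Xder (X k) v x + v x * Xder (X k) u x).
Proof.
move=> oU [uc ud] [vc vd].
have isd k x : U x -> is_Xder (X k) (fun z => u z * v z) x
    (u x * Xder (X k) v x + v x * Xder (X k) u x).
  by move=> Ux; apply: is_XderM; apply: XderP; [exact: (ud k x Ux).1|exact: (vd k x Ux).1].
split=> //; split=> [x Ux|k x Ux]; first exact: (cvgM (uc _ Ux) (vc _ Ux)).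
split; first by eexists; exact: isd.
have H : {for x, continuous (fun z => u z * Xder (X k) v z + v z * Xder (X k) u z)}.
  exact: (cvgD (cvgM (uc _ Ux) (vd k x Ux).2) (cvgM (vc _ Ux) (ud k x Ux).2)).
rewrite /prop_for /continuous_at (XderE (isd k x Ux)).
apply: (cvg_near_eq _ H).
have nU : \forall z \near x, U z by exact: open_nbhs_nbhs.
by apply: filterS nU => z Uz; exact: XderE (isd k z Uz).
Qed.

Lemma C1X_near_eq (U : set M) u v : open U -> (forall x, U x -> u x = v x) ->
  C1X X U u -> C1X X U v.
Proof.
move=> oU uv [uc ud].
have nuv x : U x -> \forall z \near x, u z = v z.
  move=> Ux; have nU : \forall z \near x, U z by exact: open_nbhs_nbhs.
  by apply: filterS nU => z; exact: uv.
have nvu x : U x -> \forall z \near x, v z = u z.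
  by move=> /nuv; apply: filterS => z ->.
split=> [x Ux|k x Ux].
  by rewrite /prop_for /continuous_at -uv//; apply: cvg_near_eq (uc _ Ux); exact: nvu.
have [uk ukc] := ud k x Ux; split.
  by exists (Xder (X k) u x); apply: near_eq_is_Xder (XderP uk); exact: nuv.
rewrite /prop_for /continuous_at -(near_eq_Xder (X k) (nuv _ Ux)).
by apply: cvg_near_eq ukc; exact: near_eq_Xder_near (nvu _ Ux).
Qed.

(** [u] is only used to know that integral curves start from [y]. *)
Lemma C1X_extend0 (U : set M) (y : M) u v : C1X X U u ->
  C1X X (U `\ y) v -> (\forall z \near y, v z = 0) -> C1X X U v.
Proof.
move=> [_ ud] [vc vd] v0.
have v0s : \forall z \near y, 0 = v z by apply: filterS v0.
have vy : v y = 0 by exact: nbhs_singleton v0.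
split=> [x Ux|k x Ux].
  have [->|xy] := eqVneq x y; last by apply: vc; split=> //; exact/eqP.
  by rewrite /prop_for /continuous_at vy; apply: cvg_near_eq (cvg_cst 0).
have [xy|xy] := eqVneq x y; last by apply: vd; split=> //; exact/eqP.
rewrite xy in Ux *; have d0 := is_Xder_cst 0 (XderP (ud k y Ux).1).
split; first by exists 0; exact: near_eq_is_Xder v0s d0.
rewrite /prop_for /continuous_at -(near_eq_Xder (X k) v0s) Xder_cst.
apply: cvg_near_eq (cvg_cst 0).
by have := near_eq_Xder_near (X k) v0; apply: filterS => z ->; rewrite Xder_cst.
Qed.
End DirectionalDerivatives.

(** * The volume measure *)

Section BorelMeasure.
Variables (R : realType) (M : ptopologicalType).

Lemma borel_open (U : set (borel M)) : open (U : set M) -> measurable U.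
Proof. by move=> oU; exact: sub_sigma_algebra. Qed.

Lemma borel_closed (U : set (borel M)) : closed (U : set M) -> measurable U.
Proof.
by move=> cU; rewrite -[U]setCK; apply: measurableC; apply: borel_open; exact: closed_openC.
Qed.

Lemma borel_continuous (D : set (borel M)) (f : M -> R) : open (D : set M) ->
  (forall x, D x -> {for (x : M), continuous f}) -> measurable_fun D f.
Proof.
move=> oD fc; apply: (measurability _ (RGenOpens.measurableE R)).
move=> /= _ [_ [a [b ->] <-]]; apply: borel_open.
rewrite openE => x [Dx fx].
have h : \forall z \near (x : M), f z \in `]a, b[.
  have o : open_nbhs (f x) `]a, b[%classic by split; [exact: interval_open|exact: fx].
  exact: (fc _ Dx _ (open_nbhs_nbhs o)).
have nD : \forall z \near (x : M), D z by exact: open_nbhs_nbhs.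
by apply: filterS2 nD h.
Qed.

Variables (n' : nat).
Let n := n'.+1.
Variables (A : manifold R n M) (w : volume_form A).

Lemma iterint0 (D : set R) m (f : 'rV[R]_m -> \bar R) :
  (forall v, f v = 0%E) -> iterint D f = 0%E.
Proof.
elim: m f => [|m IH] f f0 /=; first exact: f0.
by rewrite integral0_eq// => t _; apply: IH => v.
Qed.

(** Read in a chart, the integrand of the outermost integral vanishes unless [t] is the first
    coordinate of the point, and a single real number is Lebesgue null. *)
Lemma volume_measure_set1 (nu : {measure set (borel M) -> \bar R}) (y : M) :
  is_volume_measure w nu -> nu [set y] = 0%E.
Proof.
move=> hnu; pose i := chart_at A y.
have iy : dom i y by exact: chart_atP.
have mS : measurable ([set y] : set (borel M)).
  apply: borel_closed; apply: accessible_closed_set1; apply: hausdorff_accessible.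
  exact: manifold_hausdorff A.
have sub : ([set y] : set (borel M)) `<=` dom i by move=> _ ->.
rewrite (hnu i _ mS sub) /=.
set g := fun t : R => _.
have g0 t : t != crd i y 0 0 -> g t = 0%E.
  move=> tn; apply: iterint0 => v; rewrite indicE.
  rewrite (_ : (_ \in _) = false) ?mulr0//; apply/negbTE/negP; rewrite inE/= => -[z -> yE].
  move/eqP: tn; apply; rewrite yE.
  have : t = (row_mx t%:M v : 'rV[R]_(1 + n')) 0 (lshift n' 0) by rewrite row_mxEl mxE eqxx.
  by move=> {1}->; congr (fun_of_matrix _ _ _); exact: val_inj.
rewrite (_ : g = g \_ [set crd i y 0 0]); last first.
  apply/funext => t; rewrite /patch; case: ifPn => //; rewrite notin_setE/= => /eqP; exact: g0.
by rewrite -integral_mkcond integral_set1.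
Qed.
End BorelMeasure.

(** * Cutoff functions *)

Section Cutoff.
Variable R : realType.

Definition pospart (s : R) : R := Num.max s 0.
Definition sqpos (s : R) : R := pospart s ^+ 2.

Lemma pospart_ge0 s : 0 <= pospart s.
Proof. by rewrite le_max lexx orbT. Qed.

Lemma pospart_continuous : continuous pospart.
Proof.
have c0 : continuous (cst 0 : R -> R^o) by exact: cst_continuous.
by move=> s; exact: (continuous_max (f := id) (g := cst 0) (fun B => id) (c0 s)).
Qed.

Lemma is_derive_sqpos (s : R) : is_derive s 1 sqpos (2 * pospart s).
Proof.
have [s0|s0|->] := ltgtP s 0.
- have -> : 2 * pospart s = 0 by rewrite /pospart (max_idPr (ltW s0)) mulr0.
  have ns : \forall z \near s, cst 0 z = sqpos z.
    have : \forall z \near s, z < 0 by exact: lt_nbhsl.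
    by apply: filterS => z z0; rewrite /sqpos /pospart (max_idPr (ltW z0)) expr0n.
  exact: near_eq_is_derive ns (is_derive_cst _ _ _).
- have -> : 2 * pospart s = 2 * s by rewrite /pospart (max_idPl (ltW s0)).
  have ns : \forall z \near s, (id ^+ 2 : R -> R) z = sqpos z.
    have : \forall z \near s, 0 < z by exact: lt_nbhsr.
    by apply: filterS => z z0; rewrite /sqpos /pospart (max_idPl (ltW z0)).
  have h := is_deriveX 2 (is_derive_id s 1).
  rewrite /= expr1 /GRing.scale/= mulr1 mulr_natl in h *.
  exact: near_eq_is_derive ns h.
- rewrite /pospart maxxx mulr0.
  (* At the corner the difference quotient is [pospart] itself, which tends to 0. *)
  have q : (fun h : R => h^-1 *: ((sqpos \o shift 0) h - sqpos 0)) @ 0^' --> (0 : R).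
    apply: (@cvg_near_eq _ _ _ _ _ pospart).
      have ns : \forall h \near (0 : R)^', h != 0 by exact: nbhs_dnbhs_neq.
      apply: filterS ns => h h0; rewrite /sqpos /pospart/= addr0 maxxx expr0n subr0 /GRing.scale/=.
      have [hp|hn] := leP h 0; first by rewrite expr0n mulr0.
      by rewrite expr2 mulrA mulVf// mul1r.
    apply: cvg_within_filter.
    by have := @pospart_continuous 0; rewrite /continuous_at/= /pospart maxxx.
  have qe : (fun h : R => h^-1 *: ((sqpos \o shift 0) (h *: (1 : R)) - sqpos 0)) =
      (fun h : R => h^-1 *: ((sqpos \o shift 0) h - sqpos 0)).
    by apply/funext => h; rewrite /GRing.scale/= mulr1.
  apply: DeriveDef; first by rewrite /derivable qe; apply/cvg_ex; exists 0.
  by rewrite /derive qe; exact/cvg_lim.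
Qed.

(** Equal to 1 for [s <= S] and to 0 for [2 * S <= s]. Squaring the positive parts makes it C^1,
    with derivative [dcutoff]. *)
Definition cutoff (S s : R) : R := sqpos (1 - sqpos (s / S - 1)).
Definition dcutoff (S s : R) : R :=
  2 * pospart (1 - sqpos (s / S - 1)) * - (2 * pospart (s / S - 1) / S).

Lemma is_derive_continuous (f : R -> R) (s d : R) : is_derive s 1 f d -> {for s, continuous f}.
Proof. by move=> [fd _]; apply: differentiable_continuous; exact/derivable1_diffP. Qed.

Lemma is_derive_rescale (S s : R) : is_derive s 1 (fun s => s / S - 1) S^-1.
Proof.
have := is_deriveB (is_deriveZ S^-1 (is_derive_id s 1)) (is_derive_cst (1 : R) s 1).
rewrite subr0 /GRing.scale/= mulr1.
set f := (X in is_derive _ _ X _); suff -> : f = (fun s => s / S - 1) by [].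
by apply/funext => z; rewrite mulrC.
Qed.

Lemma is_derive_cutoff (S s : R) : is_derive s 1 (cutoff S) (dcutoff S s).
Proof.
have d1 := is_derive_rescale S s.
have d2 := @is_derive1_comp R sqpos (fun s => s / S - 1) s _ _ (is_derive_sqpos (s / S - 1)) d1.
have d3 : is_derive s 1 (fun s => 1 - sqpos (s / S - 1)) (- (2 * pospart (s / S - 1) / S)).
  by have := is_deriveB (is_derive_cst (1 : R) s 1) d2; rewrite sub0r.
exact: (@is_derive1_comp R sqpos (fun s => 1 - sqpos (s / S - 1)) s _ _
  (is_derive_sqpos (1 - sqpos (s / S - 1))) d3).
Qed.

Lemma sqpos_continuous : continuous sqpos.
Proof. by move=> s; exact: is_derive_continuous (is_derive_sqpos s). Qed.

Lemma dcutoff_continuous S : continuous (dcutoff S).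
Proof.
move=> s; pose f1 (s : R) := s / S - 1; pose f2 (s : R) := 1 - sqpos (f1 s).
have c1 : {for s, continuous f1} by exact: is_derive_continuous (is_derive_rescale S s).
have c2 : {for s, continuous f2}.
  have h := @continuous_comp _ _ _ f1 sqpos s c1 (@sqpos_continuous _).
  by apply: cvgB => //; exact: cvg_cst.
have c3 := @continuous_comp _ _ _ f1 pospart s c1 (@pospart_continuous _).
have c4 := @continuous_comp _ _ _ f2 pospart s c2 (@pospart_continuous _).
apply: cvgM; first by apply: cvgM; [exact: cvg_cst|exact: c4].
by apply: cvgN; apply: cvgM; [apply: cvgM; [exact: cvg_cst|exact: c3]|exact: cvg_cst].
Qed.

Section Bounds.
Variables (S s : R).
Hypothesis S0 : 0 < S.

Lemma cutoff_eq1 : s <= S -> cutoff S s = 1 /\ dcutoff S s = 0.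
Proof.
move=> sS; have h : pospart (s / S - 1) = 0.
  by rewrite /pospart (max_idPr _)// subr_le0 ler_pdivrMr// mul1r.
rewrite /cutoff /dcutoff /sqpos h expr0n subr0 /pospart (max_idPl _)// expr1n.
by rewrite mulr0 mul0r oppr0 mulr0.
Qed.

Lemma cutoff_eq0 : 2 * S <= s -> cutoff S s = 0 /\ dcutoff S s = 0.
Proof.
move=> sS; have h : pospart (1 - sqpos (s / S - 1)) = 0.
  rewrite /pospart (max_idPr _)// subr_le0 /sqpos -[1](expr1n R 2) ler_pXn2r ?nnegrE ?pospart_ge0//.
  have h : 2 <= s / S by rewrite ler_pdivlMr.
  by rewrite /pospart le_max; apply/orP; left; lra.
by rewrite /cutoff /dcutoff {1}/sqpos h expr0n mulr0 mul0r.
Qed.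

Lemma cutoff_ge0 : 0 <= cutoff S s.
Proof. exact: sqr_ge0. Qed.

Lemma pospart_le1 : pospart (1 - sqpos (s / S - 1)) <= 1.
Proof. by rewrite /pospart ge_max ler01 andbT gerBl sqr_ge0. Qed.

Lemma cutoff_le1 : cutoff S s <= 1.
Proof.
by rewrite /cutoff {1}/sqpos expr_le1// ?pospart_le1 ?pospart_ge0.
Qed.

Lemma dcutoff_le0 : dcutoff S s <= 0.
Proof.
rewrite /dcutoff mulrN oppr_le0 !mulr_ge0 ?pospart_ge0// invr_ge0; exact: ltW.
Qed.

(** The product depends on [s / S] only, hence a bound uniform in [S], which makes dominated
    convergence possible. Where the derivative is nonzero, [s / S <= 2] and both positive parts are
    at most 1; the prefactor is 4. *)
Lemma dcutoff_bound : 0 <= s -> `|s * dcutoff S s| <= 8.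
Proof.
move=> s0; have [sS|sS] := leP (2 * S) s.
  by rewrite (cutoff_eq0 sS).2 mulr0 normr0.
rewrite normrM (ger0_norm s0) ler0_norm ?dcutoff_le0//.
have sS2 : s / S <= 2 by rewrite ler_pdivrMr// ltW.
have p1 : pospart (s / S - 1) <= 1 by rewrite /pospart ge_max ler01 andbT; lra.
have p2 := pospart_le1; have p3 := pospart_ge0 (s / S - 1).
have p4 := pospart_ge0 (1 - sqpos (s / S - 1)).
have sS0 : 0 <= s / S by rewrite divr_ge0// ltW.
rewrite (_ : s * _ = 4 * (pospart (1 - sqpos (s / S - 1)) * pospart (s / S - 1)) * (s / S)); last by rewrite /dcutoff; ring.
have q1 : pospart (1 - sqpos (s / S - 1)) * pospart (s / S - 1) <= 1 by rewrite mulr_ile1.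
by nra.
Qed.
End Bounds.
End Cutoff.

(** * Integrals of real functions and removal of the cutoff *)

Section RealIntegrals.
Context d (T : measurableType d) (R : realType) (mu : {measure set T -> \bar R}).
Variables (D : set T) (mD : measurable D).
Implicit Types f g : T -> R.

Lemma integrable_ler f g : measurable_fun D f -> (forall x, D x -> `|f x| <= g x) ->
  mu.-integrable D (EFin \o g) -> mu.-integrable D (EFin \o f).
Proof.
move=> mf fg; apply: (le_integrable mD); first exact/measurable_EFinP.
by move=> x Dx; rewrite /= lee_fin (le_trans (fg _ Dx))// ler_norm.
Qed.

Lemma integrable_add f g : mu.-integrable D (EFin \o f) -> mu.-integrable D (EFin \o g) ->
  mu.-integrable D (EFin \o (fun x => f x + g x)).
Proof. by move=> fi gi; exact: (integrableD mD fi gi). Qed.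

Lemma integrable_scale k f : mu.-integrable D (EFin \o f) ->
  mu.-integrable D (EFin \o (fun x => k * f x)).
Proof. by move=> fi; exact: (integrableZl mD k fi). Qed.

Lemma integrable_measurable f : mu.-integrable D (EFin \o f) -> measurable_fun D f.
Proof. by move=> /measurable_int/measurable_EFinP. Qed.

Lemma integrable_mul_bounded (C : R) f g : measurable_fun D g ->
  (forall x, D x -> `|g x| <= C) -> mu.-integrable D (EFin \o f) ->
  mu.-integrable D (EFin \o (fun x => g x * f x)).
Proof.
move=> mg gC fi; apply: (@integrable_ler _ (fun x => C * `|f x|)).
- by apply: measurable_funM => //; exact: integrable_measurable.
- by move=> x Dx; rewrite normrM ler_wpM2r// gC.
- by apply: integrable_scale; exact: integrable_norm.
Qed.

Lemma integrable_sumr (I : Type) (r : seq I) (f : I -> T -> R) :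
  (forall k, mu.-integrable D (EFin \o f k)) ->
  mu.-integrable D (EFin \o (fun x => \sum_(k <- r) f k x)).
Proof.
move=> fi; elim: r => [|k r IH].
  rewrite (_ : _ \o _ = (fun=> 0%E)); first exact: integrable0.
  by apply/funext => x /=; rewrite big_nil.
rewrite (_ : (fun x => \sum_(k0 <- (k :: r)) f k0 x) = (fun x => f k x + \sum_(k0 <- r) f k0 x)).
  exact: integrable_add.
by apply/funext => x; rewrite big_cons.
Qed.

Variables (G : T -> R).
Hypotheses (mG : measurable_fun D G) (G0 : forall x, D x -> 0 < G x).

Lemma measurable_cutoff S : measurable_fun D (fun x => cutoff S (G x)).
Proof.
apply: (measurableT_comp (f := cutoff S)) => //; apply: continuous_measurable_fun => s.
exact: is_derive_continuous (is_derive_cutoff S s).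
Qed.

Lemma measurable_dcutoff S : measurable_fun D (fun x => dcutoff S (G x)).
Proof.
apply: (measurableT_comp (f := dcutoff S)) => //; apply: continuous_measurable_fun.
exact: dcutoff_continuous.
Qed.

(** This combination is the shape of the divergence of a truncated field: [f] collects the terms
    that leave the cutoff alone, and [g] is what remains of the term that differentiates it once
    [G * dcutoff] is factored out. *)
Lemma integrable_cutoff (S : R) f g : 0 < S ->
  mu.-integrable D (EFin \o f) -> mu.-integrable D (EFin \o g) ->
  mu.-integrable D (EFin \o (fun x => cutoff S (G x) * f x + G x * dcutoff S (G x) * g x)).
Proof.
move=> S0 fi gi; apply: integrable_add.
  apply: (@integrable_mul_bounded 1) => //; first exact: measurable_cutoff.
  by move=> x Dx; rewrite ger0_norm ?cutoff_le1 ?cutoff_ge0.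
apply: (@integrable_mul_bounded 8) => //.
  by apply: measurable_funM => //; exact: measurable_dcutoff.
by move=> x Dx; apply: dcutoff_bound => //; exact/ltW/G0.
Qed.

Lemma near_cutoff_eq1 x : \forall n \near \oo,
  cutoff n.+1%:R (G x) = 1 /\ dcutoff n.+1%:R (G x) = 0.
Proof.
near=> n; apply: cutoff_eq1 => //; apply: (@le_trans _ _ n%:R); last by rewrite ler_nat.
by near: n; exact: nbhs_infty_ger.
Unshelve. all: by end_near. Qed.

(** At each point the integrand equals [f x] as soon as [n] exceeds [G x], and [|f| + 8 * |g|]
    dominates the whole sequence. *)
Lemma integral_cutoff_limit f g (c : R) n0 :
  mu.-integrable D (EFin \o f) -> mu.-integrable D (EFin \o g) ->
  (forall n, (n0 <= n)%N -> \int[mu]_(x in D)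
     (cutoff n.+1%:R (G x) * f x + G x * dcutoff n.+1%:R (G x) * g x) = c) ->
  \int[mu]_(x in D) f x = c.
Proof.
move=> fi gi hc.
pose h n x := cutoff n.+1%:R (G x) * f x + G x * dcutoff n.+1%:R (G x) * g x.
have hi n : mu.-integrable D (EFin \o h n) by exact: integrable_cutoff.
have [||||| _ _] := @dominated_convergence _ T R mu D mD (fun n x => (h n x)%:E)
  (EFin \o f) (EFin \o (fun x => `|f x| + 8 * `|g x|)).
- by move=> n; exact: measurable_int (hi n).
- exact: measurable_int fi.
- apply: aeW => x Dx; apply: cvg_near_cst.
  by apply: filterS (near_cutoff_eq1 x) => n [e1 e2]; rewrite /h e1 e2 mul1r mulr0 mul0r addr0.
- apply: integrable_add; first exact: integrable_norm.
  by apply: integrable_scale; exact: integrable_norm.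
- apply: aeW => x n Dx; rewrite /= lee_fin (le_trans (ler_normD _ _))// lerD//.
    by rewrite normrM ler_piMl// ger0_norm ?cutoff_le1 ?cutoff_ge0.
  by rewrite normrM ler_wpM2r// dcutoff_bound//; exact/ltW/G0.
move=> lim.
have lim' : (\int[mu]_(x in D) (h n x)%:E)%E @[n --> \oo] --> c%:E.
  apply: cvg_near_cst; exists n0 => // n /= n0n.
  by rewrite -(hc n n0n) fineK//; exact: integrable_fin_num (hi n).
by rewrite /Rintegral (cvg_unique _ lim lim').
Qed.

(** Fatou's lemma: the truncated integrands are nonnegative and eventually equal to [f x] at each
    point. The sequence is shifted by [n0] so that the bound holds for all its terms. *)
Lemma integrable_of_cutoff f (C : R) n0 : measurable_fun D f ->
  (forall x, D x -> 0 <= f x) ->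
  (forall n, (n0 <= n)%N -> (\int[mu]_(x in D) (cutoff n.+1%:R (G x) * f x)%:E <= C%:E)%E) ->
  mu.-integrable D (EFin \o f).
Proof.
move=> mf f0 hC; apply/integrableP; split; first exact/measurable_EFinP.
apply: (@le_lt_trans _ _ C%:E); last exact: ltry.
pose h n x := (cutoff (n + n0).+1%:R (G x) * f x)%:E.
have mh n : measurable_fun D (h n).
  by apply/measurable_EFinP; apply: measurable_funM => //; exact: measurable_cutoff.
have h0 n x : D x -> (0 <= h n x)%E.
  by move=> Dx; rewrite lee_fin mulr_ge0 ?cutoff_ge0// f0.
have hcv x : D x -> limn_einf (h^~ x) = `|(f x)%:E|%E.
  move=> Dx; have : h^~ x @ \oo --> (f x)%:E.
    apply: cvg_near_cst.
    have [N _ hN] := near_cutoff_eq1 x; exists N => // n /= Nn.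
    by rewrite /h (hN _ _).1 ?mul1r//= (leq_trans Nn)// leq_addr.
  move=> /[dup] cv /cvg_limn_einf_sup [-> _].
  by rewrite gee0_abs// lee_fin f0.
have -> : (\int[mu]_(x in D) `|(EFin \o f) x| = \int[mu]_(x in D) limn_einf (h^~ x))%E.
  by apply: eq_integral => x; rewrite inE => Dx; rewrite hcv.
have H := fatou mu mD mh h0; apply: le_trans H _.
apply: (le_trans (limn_einf_sup _)); rewrite limn_esup_lim.
apply: lime_le; first exact: is_cvg_esups.
apply: nearW => n; apply: ge_ereal_sup => _ [k _ <-]; apply: hC; exact: leq_addl.
Qed.
End RealIntegrals.

(** * Real powers of positive numbers *)

Section Powers.
Variable R : realType.
Implicit Types s a b : R.

Lemma powR_add s a b : 0 < s -> s `^ a * s `^ b = s `^ (a + b).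
Proof. by move=> s0; rewrite powRD//; apply/implyP => _; rewrite gt_eqF. Qed.

Lemma powR_divl s a : 0 < s -> s `^ a / s = s `^ (a - 1).
Proof. move=> s0; rewrite powRB; first by rewrite powRr1// ltW.
by apply/implyP => _; rewrite gt_eqF. Qed.

Lemma powR_mull s a : 0 < s -> s * s `^ a = s `^ (1 + a).
Proof. by move=> s0; rewrite -{1}(powRr1 (ltW s0)) powR_add. Qed.

Lemma powR_continuous s a : 0 < s -> {for s, continuous (fun t => t `^ a)}.
Proof. by move=> s0; exact: is_derive_continuous (is_derive1_powR a s0). Qed.

Lemma is_derive_powR_continuous s a : 0 < s ->
  is_derive s 1 (fun t => t `^ a) (a * s `^ (a - 1)) /\
  {for s, continuous (fun t => a * t `^ (a - 1))}.
Proof.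
move=> s0; split; first exact: is_derive1_powR.
by apply: cvgM; [exact: cvg_cst|exact: powR_continuous].
Qed.

Lemma powRN_le c s a : 0 < c -> c <= s -> 0 <= a -> s `^ (- a) <= c `^ (- a).
Proof.
move=> c0 cs a0; have s0 := lt_le_trans c0 cs.
rewrite !powRN lef_pV2 ?posrE ?powR_gt0//.
by apply: ge0_ler_powR => //; rewrite nnegrE; exact: ltW.
Qed.
End Powers.

Section LinearCombination.
Context d (T : measurableType d) (R : realType) (mu : {measure set T -> \bar R}).
Variables (D : set T) (mD : measurable D).

(** Returning integrability together with the value lets a long linear combination be integrated one
    term at a time. *)
Lemma Rintegral_axpy (k : R) (f g : T -> R) :
  mu.-integrable D (EFin \o f) -> mu.-integrable D (EFin \o g) ->
  mu.-integrable D (EFin \o (fun x => k * f x + g x)) /\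
  \int[mu]_(x in D) (k * f x + g x) =
  k * \int[mu]_(x in D) f x + \int[mu]_(x in D) g x.
Proof.
move=> fi gi; have kfi := integrable_scale mD k fi.
by split; [exact: integrable_add|rewrite RintegralD// RintegralZl].
Qed.
End LinearCombination.

(** * Strongly admissible domains *)

Section Compactness.
Variables (R : realType) (M : topologicalType).

Lemma compact_continuous_bounded (K : set M) (f : M -> R) : compact K ->
  {within K, continuous f} -> exists C, forall x, K x -> `|f x| <= C.
Proof.
move=> cK fc; have := compact_bounded (continuous_compact fc cK).
move=> [B [_ hB]]; exists (B + 1) => x Kx; apply: (hB (B + 1)); last by exists x.
by rewrite ltrDl.
Qed.

Lemma continuous_within (K : set M) (f : M -> R) :
  (forall x, K x -> {for x, continuous f}) -> {within K, continuous f}.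
Proof.
by move=> fc; apply: continuous_in_subspaceT => x; rewrite inE; exact: fc.
Qed.
End Compactness.

(** * The fundamental solution on the punctured domain *)

Section Setting.
Variables (R : realType) (n' : nat) (M : ptopologicalType).
Let n := n'.+1.
Variables (A : manifold R n M) (w : volume_form A).
Variables (nu : {measure set (borel M) -> \bar R}) (hnu : is_volume_measure w nu).
Variables (N : nat) (X : 'I_N -> vector_field A) (y : M) (T : set M) (G : M -> R).
Hypothesis hA : assumption_Aplus nu X y T G.
Variables (Omega : set (borel M)) (S : patches R n M).
Hypothesis hOmega : strongly_admissible w nu X S Omega y T G.
Hypothesis hy : ~ (closure (Omega : set M) `\` Omega) y.

(** [G] is regular only away from the pole, so integrals are computed on the punctured domain; the
    pole is a null set. *)
Let D : set (borel M) := Omega `\ y.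
Let clO : set M := closure (Omega : set M).
Let bdO : set M := clO `\` Omega.

Lemma open_domain : open (Omega : set M). Proof. by case: hOmega => -[]. Qed.

Lemma closed_pt : closed ([set y] : set M).
Proof.
apply: accessible_closed_set1; apply: hausdorff_accessible.
exact: manifold_hausdorff A.
Qed.

Lemma open_punctured : open (D : set M).
Proof. by apply: openI; [exact: open_domain|exact: closed_openC closed_pt]. Qed.

Lemma measurable_pt : measurable ([set y] : set (borel M)).
Proof. by apply: borel_closed; exact: closed_pt. Qed.

Lemma measurable_punctured : measurable D. Proof. by apply: borel_open; exact: open_punctured. Qed.
Lemma measurable_domain : measurable Omega. Proof. by apply: borel_open; exact: open_domain. Qed.

Lemma nu_pt : nu [set y] = 0%E. Proof. exact: volume_measure_set1 hnu. Qed.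

Lemma compact_clO : compact clO. Proof. by case: hOmega => -[]. Qed.

Lemma clO_T x : clO x -> T x. Proof. by case: hOmega => _ _ h _; exact: h. Qed.

Lemma D_clO x : D x -> clO x /\ x <> y.
Proof. by move=> [Ox xy]; split=> //; exact: subset_closure. Qed.

Lemma bd_clO x : bdO x -> clO x /\ x <> y.
Proof. by move=> bx; split; [case: bx|move=> xy; apply: hy; rewrite -xy]. Qed.

Lemma G_C2 : C2X X (T `\ y) G. Proof. by case: hA => -[]. Qed.

Lemma G_gt0 x : clO x -> x <> y -> 0 < G x.
Proof. by case: hA => _ + _ cx xy; apply; split=> //; exact: clO_T. Qed.

Lemma G_continuous x : clO x -> x <> y -> {for x, continuous G}.
Proof.
by move=> cx xy; have [[h _] _] := G_C2; apply: h; split=> //; exact: clO_T.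
Qed.

Lemma G_Xder k x : clO x -> x <> y ->
  Xderivable (X k) G x /\ {for x, continuous (Xder (X k) G)}.
Proof.
by move=> cx xy; have [[_ h] _] := G_C2; apply: h; split=> //; exact: clO_T.
Qed.

Lemma G_C1D : C1X X D G.
Proof.
split=> [x /D_clO[cx xy]|k x /D_clO[cx xy]]; first exact: G_continuous.
exact: G_Xder.
Qed.

(** Positivity of [G] turns the convergence of [1 / G] to 0 at the pole into blow-up of [G]. *)
Lemma near_G_large s : \forall z \near y, z <> y -> s < G z.
Proof.
case: hA => -[oT Ty _ _] G0 Glim.
have e0 : 0 < (`|s| + 1)^-1 by rewrite invr_gt0 ltr_wpDl.
have /cvgrPdist_lt/(_ _ e0) := Glim.
have nT : \forall z \near y, T z by exact: open_nbhs_nbhs.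
rewrite /dnbhs near_withinE; apply: filterS2 nT => z Tz h zy.
have Gz : 0 < G z by apply: G0.
have := h; rewrite sub0r normrN => /(_ _)-/(_ _).
have zy' : z != y by exact/eqP.
move=> /(_ zy'); rewrite ger0_norm ?invr_ge0 ?ltW// ltf_pV2 ?posrE// ?ltr_wpDl// => h2.
by rewrite (le_lt_trans (ler_norm s))// (lt_trans _ h2)// ltrDl.
Qed.

(** A sublevel set of [G] avoids a neighbourhood [U] of the pole, and the closure minus [U] is
    compact. *)
Lemma bounded_sublevel (f : M -> R) s :
  (forall x, clO x -> x <> y -> {for x, continuous f}) ->
  exists C, forall x, clO x -> x <> y -> G x <= s -> `|f x| <= C.
Proof.
move=> fc; pose U := interior [set z | z <> y -> s < G z].
have cK : compact (clO `\` U).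
  by apply: compact_closedI compact_clO _; apply: open_closedC; exact: open_interior.
have Uy : U y by exact: near_G_large.
have [C hC] : exists C, forall x, (clO `\` U) x -> `|f x| <= C.
  apply: compact_continuous_bounded cK _; apply: continuous_within => x [cx Ux].
  by apply: fc => // xy; apply: Ux; rewrite xy.
exists C => x cx xy Gs; apply: hC; split=> // Ux.
by have := nbhs_singleton Ux xy; rewrite ltNge Gs.
Qed.

(** Where [G <= 1], the function [1 / G] is bounded by compactness; elsewhere 1 is a lower bound of
    [G]. *)
Lemma G_min : exists2 c, 0 < c & forall x, clO x -> x <> y -> c <= G x.
Proof.
have [C hC] : exists C, forall x, clO x -> x <> y -> G x <= 1 -> `|(G x)^-1| <= C.
  apply: bounded_sublevel => x cx xy.
  by apply: cvgV; [rewrite gt_eqF// G_gt0|exact: G_continuous].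
have m0 : 0 < Num.min 1 (`|C| + 1)^-1 by rewrite lt_min ltr01/= invr_gt0 ltr_wpDl.
exists (Num.min 1 (`|C| + 1)^-1) => // x cx xy; have G0 := G_gt0 cx xy.
have [G1|G1] := leP (G x) 1; last by rewrite ge_min (ltW G1).
have := hC x cx xy G1; rewrite ger0_norm ?invr_ge0 ?(ltW G0)// => h.
rewrite ge_min; apply/orP; right.
rewrite -[leRHS]invrK lef_pV2 ?posrE ?invr_gt0 ?ltr_wpDl//.
by rewrite (le_trans h)// (le_trans (ler_norm C))// lerDl.
Qed.

(** The boundary is compact and misses the pole. Beyond the level [n0] the cutoff equals 1 on the
    boundary, so truncation leaves the fluxes unchanged. *)
Lemma G_bd : exists n0, forall x, bdO x -> G x <= n0%:R.
Proof.
have cK : compact bdO.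
  by apply: compact_closedI compact_clO _; apply: open_closedC; exact: open_domain.
have [C hC] : exists C, forall x, bdO x -> `|G x| <= C.
  apply: compact_continuous_bounded cK _; apply: continuous_within => x.
  by move=> /bd_clO[cx xy]; exact: G_continuous.
exists (Num.bound C) => x bx; have h := hC x bx.
have C0 : 0 <= C by exact: le_trans h.
rewrite (le_trans (ler_norm _))// (le_trans h)//.
exact/ltW/archi_boundP.
Qed.

Lemma measurable_D_continuous (f : M -> R) :
  (forall x, D x -> {for (x : M), continuous f}) -> measurable_fun D f.
Proof. by move=> fc; apply: borel_continuous => //; exact: open_punctured. Qed.

Lemma measurable_G : measurable_fun D G.
Proof. by apply: measurable_D_continuous => x /D_clO[]; exact: G_continuous. Qed.

Lemma measurable_XG k : measurable_fun D (Xder (X k) G).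
Proof.
by apply: measurable_D_continuous => x /D_clO[cx xy]; exact: (G_Xder k cx xy).2.
Qed.

(** Integrability on compact subsets of [T] is part of [fundamental_solution], and the closure of
    the domain is such a subset. *)
Lemma integrable_G : nu.-integrable D (EFin \o G).
Proof.
case: hA => -[_ _ _ [h _]] _ _.
have cl : measurable (clO : set (borel M)).
  by apply: borel_closed; exact: closed_closure.
apply: (integrableS cl measurable_punctured).
  by move=> x /D_clO[].
exact: h compact_clO clO_T.
Qed.

(** [G] serves as majorant: it is integrable and at least [c > 0], so the constant [C] is dominated
    by [C / c * G]. *)
Lemma integrable_bounded (f : M -> R) C : measurable_fun D f ->
  (forall x, D x -> `|f x| <= C) -> nu.-integrable D (EFin \o f).
Proof.
move=> mf fC; have [c c0 hc] := G_min.
apply: (integrable_ler measurable_punctured (g := fun x => C / c * G x)) => //.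
  move=> x Dx; rewrite (le_trans (fC _ Dx))//.
  have C0 : 0 <= C by apply: le_trans (fC _ Dx).
  have [cx xy] := D_clO Dx.
  by rewrite mulrAC ler_pdivlMr// ler_wpM2l// hc.
by apply: integrable_scale; [exact: measurable_punctured|exact: integrable_G].
Qed.

Lemma measurable_on_domain (f : M -> \bar R) :
  measurable_fun D (f : borel M -> \bar R) -> measurable_fun Omega (f : borel M -> \bar R).
Proof.
move=> mf; have -> : Omega = D `|` (Omega `&` [set y]).
  apply/seteqP; split=> x; last by case=> -[].
  by move=> Ox; have [xy|/eqP xy] := eqVneq x y; [right|left].
have mI : measurable (Omega `&` [set y] : set (borel M)).
  exact: (measurableI _ _ measurable_domain measurable_pt).
apply: (measurable_funU (f : borel M -> \bar R) measurable_punctured mI).2; split=> //.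
apply: (measurable_funS measurable_pt (@subIsetr _ _ _)); exact: measurable_fun_set1.
Qed.

Lemma integrable_domain (f : M -> \bar R) :
  nu.-integrable D f -> nu.-integrable Omega f /\ (\int[nu]_(x in Omega) f x = \int[nu]_(x in D) f x)%E.
Proof.
move=> fi; have fO : nu.-integrable Omega f.
  apply/(negligible_integrable measurable_pt measurable_domain _ nu_pt) => //.
  by apply: measurable_on_domain; exact: measurable_int fi.
split=> //; exact: (negligible_integral measurable_pt measurable_domain fO nu_pt).
Qed.

Lemma ge0_integral_domain (f : M -> \bar R) : measurable_fun D (f : borel M -> \bar R) ->
  (forall x, 0 <= f x)%E -> (\int[nu]_(x in Omega) f x = \int[nu]_(x in D) f x)%E.
Proof.
move=> mf f0; apply: (ge0_negligible_integral measurable_pt measurable_domain _ _ nu_pt) => //.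
exact: measurable_on_domain.
Qed.

Lemma near_neq (x : M) : x <> y -> \forall z \near x, z <> y.
Proof.
by move=> xy; apply: open_nbhs_nbhs; split=> //; exact: closed_openC closed_pt.
Qed.

Definition gradG2 (x : M) : R := \sum_(k < N) Xder (X k) G x ^+ 2.
Definition dotG (g : M -> R) (x : M) : R := \sum_(k < N) Xder (X k) g x * Xder (X k) G x.

Lemma gradG2_ge0 x : 0 <= gradG2 x.
Proof. by apply: sumr_ge0 => k _; exact: sqr_ge0. Qed.

Lemma gradG2_continuous x : clO x -> x <> y -> {for x, continuous gradG2}.
Proof.
move=> cx xy; apply: (cvg_sumr (F := nbhs x)) => k.
by apply: cvgM; exact: (G_Xder k cx xy).2.
Qed.

(** * Divergence formula for [F(G) g grad G] *)

Section Profile.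
Variables (F dF : R -> R).
Hypothesis hF : forall x, clO x -> x <> y ->
  is_derive (G x) 1 F (dF (G x)) /\ {for G x, continuous dF}.

(** The value at the pole is imposed, because [G y] has no meaning; with the value 0 the profile
    vanishes on a full neighbourhood of [y]. *)
Definition profile (s : R) (x : M) : R :=
  if x == y then 0 else cutoff s (G x) * F (G x).

Lemma near_profile0 s : 0 < s -> \forall z \near y, profile s z = 0.
Proof.
move=> s0; apply: filterS (near_G_large (2 * s)) => z hz; rewrite /profile.
by case: eqVneq => // /eqP zy; rewrite (cutoff_eq0 s0 (ltW (hz zy))).1 mul0r.
Qed.

Let phi s t := cutoff s t * F t.
Let dphi s t := cutoff s t * dF t + F t * dcutoff s t.

Lemma is_derive_phi s x : clO x -> x <> y -> is_derive (G x) 1 (phi s) (dphi s (G x)).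
Proof.
move=> cx xy; have [Fd _] := hF cx xy.
exact: (is_deriveM (is_derive_cutoff s (G x)) Fd).
Qed.

Lemma profile_eq s x : x <> y -> profile s x = phi s (G x).
Proof. by move=> /eqP/negbTE xy; rewrite /profile xy. Qed.

Lemma profile_continuous s x : 0 < s -> clO x -> {for x, continuous (profile s)}.
Proof.
move=> s0 cx; have [xy|/eqP xy] := eqVneq x y.
  rewrite xy; rewrite /prop_for /continuous_at {2}/profile eqxx.
  by apply: cvg_near_eq (cvg_cst 0); exact: near_profile0.
rewrite /prop_for /continuous_at profile_eq//.
apply: (cvg_near_eq (F := nbhs x) (g := phi s \o G)).
  by apply: filterS (near_neq xy) => z zy; exact: profile_eq.
have c := is_derive_continuous (is_derive_phi s cx xy).
have H := @continuous_comp _ _ _ G (phi s) x (G_continuous cx xy) c; exact: H.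
Qed.

(** Away from the pole this is the chain rule; at the pole the profile is locally zero. *)
Lemma profile_C1X s u : 0 < s -> C1X X Omega u -> C1X X Omega (profile s) /\
  forall k x, D x -> is_Xder (X k) (profile s) x (dphi s (G x) * Xder (X k) G x).
Proof.
move=> s0 uC.
have dphic x : D x -> {for G x, continuous (dphi s)}.
  move=> /D_clO[cx xy]; have [Fd dFc] := hF cx xy.
  have cc := is_derive_continuous (is_derive_cutoff s (G x)).
  have Fc := is_derive_continuous Fd.
  by apply: cvgD; apply: cvgM => //; exact: dcutoff_continuous.
have [C1 hX] := C1X_comp open_punctured G_C1D (phi := phi s) (dphi := dphi s)
  (fun x Dx => let: conj cx xy := D_clO Dx in is_derive_phi s cx xy) dphic.
have eqp x : D x -> (phi s \o G) x = profile s x by move=> /D_clO[_ xy]; rewrite profile_eq.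
split.
  apply: C1X_extend0 uC _ (near_profile0 s0).
  exact: C1X_near_eq open_punctured eqp C1.
move=> k x Dx; apply: near_eq_is_Xder (hX k x Dx).
have nD : \forall z \near (x : M), D z by apply: open_nbhs_nbhs; split=> //; exact: open_punctured.
by apply: filterS nD.
Qed.

(** Strong admissibility for [v = profile * g]: on the punctured domain [q] is the product of the
    gradients of [v] and [G], and on the boundary the cutoff equals 1, so the flux is that of
    [F(G) g]. *)
Lemma green_truncated (g : M -> R) (m : nat) : (forall x, bdO x -> G x <= m%:R) ->
  C1X X Omega g -> {within clO, continuous g} ->
  let q x := cutoff m.+1%:R (G x) * (dF (G x) * g x * gradG2 x + F (G x) * dotG g x)
    + G x * dcutoff m.+1%:R (G x) * (F (G x) / G x * g x * gradG2 x) in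
  nu.-integrable D (EFin \o q) ->
  \int[nu]_(x in D) q x =
  flux w X S (fun x => F (G x) * g x) (fun k => Xder (X k) G).
Proof.
move=> hm gC gc q qi; pose s : R := m.+1%:R; have s0 : 0 < s by [].
have [pC pX] := profile_C1X s0 gC.
pose v x := profile s x * g x.
have [vC vX] := C1X_mul open_domain pC gC.
have v0 : \forall z \near y, v z = 0.
  by apply: filterS (near_profile0 s0) => z h; rewrite /v h mul0r.
have vc : {within clO, continuous v}.
  apply/subspace_continuousP => x cx; apply: cvgM.
    exact: cvg_within_filter (profile_continuous s0 cx).
  by move/subspace_continuousP : gc; exact.
have vD x : D x -> \sum_(k < N) Xder (X k) v x * Xder (X k) G x = q x.
  move=> Dx; have [cx xy] := D_clO Dx; have [Ox _] := Dx.
  have G0 : G x != 0 by rewrite gt_eqF// G_gt0.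
  have -> : q x = dphi s (G x) * g x * gradG2 x + phi s (G x) * dotG g x.
    by rewrite /q /dphi /phi -/s; field.
  rewrite /gradG2 /dotG !mulr_sumr -big_split; apply: eq_bigr => k _ /=.
  rewrite (XderE (vX k x Ox)) (XderE (pX k x Dx)) profile_eq//; ring.
have vi : nu.-integrable D (EFin \o fun x => \sum_(k < N) Xder (X k) v x * Xder (X k) G x).
  apply: (eq_integrable measurable_punctured (EFin \o q)) => // x; rewrite inE => Dx /=.
  by rewrite vD.
have [viO viE] := integrable_domain vi.
case: hOmega => -[_ _ hS _] _ _ /(_ v vC vc viO).
(* The contribution [v y] of the Dirac mass is zero since [v] vanishes near the pole. *)
rewrite [X in (X - _)%E]viE (nbhs_singleton v0) mulr0 sube0 => E.
have <- : \sum_(k < N) single_flux w X S k (fun x => v x * Xder (X k) G x) =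
    flux w X S (fun x => F (G x) * g x) (fun k => Xder (X k) G).
  rewrite -(@fluxE _ _ _ _ w _ _ _ _ hS v (fun k => Xder (X k) G)).
    apply: (@eq_flux _ _ _ _ w _ _ _ _ hS) => x k bx; have [cx xy] := bd_clO bx.
    rewrite /v profile_eq// /phi (cutoff_eq1 s0 _).1 ?mul1r//.
    by rewrite (le_trans (hm _ bx))// ler_nat.
  move=> k; apply/subspace_continuousP => x cx.
  (* At the pole [Xder (X k) G] is uncontrolled, but its product with [v] is identically zero
     nearby. *)
  have [xy|/eqP xy] := eqVneq x y.
    have H : (fun z => v z * Xder (X k) G z) @ y --> v y * Xder (X k) G y.
      rewrite (nbhs_singleton v0) mul0r; apply: cvg_near_eq (cvg_cst 0).
      by apply: filterS v0 => z ->; rewrite mul0r.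
    by rewrite xy; exact: cvg_within_filter H.
  apply: cvgM; first by move/subspace_continuousP : vc; exact.
  exact: cvg_within_filter (G_Xder k cx xy).2.
apply: EFin_inj; rewrite -E /Rintegral fineK; last exact: (integrable_fin_num measurable_punctured qi).
by apply: eq_integral => x; rewrite inE => Dx; congr EFin; exact: esym (vD x Dx).
Qed.

(** The second integrability assumption concerns the term that differentiates the cutoff: the
    division by [G] balances the factor [G * dcutoff], which is bounded uniformly. *)
Lemma green_limit (g : M -> R) : C1X X Omega g -> {within clO, continuous g} ->
  nu.-integrable D (EFin \o (fun x => dF (G x) * g x * gradG2 x + F (G x) * dotG g x)) ->
  nu.-integrable D (EFin \o (fun x => F (G x) / G x * g x * gradG2 x)) ->
  \int[nu]_(x in D) (dF (G x) * g x * gradG2 x + F (G x) * dotG g x) =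
  flux w X S (fun x => F (G x) * g x) (fun k => Xder (X k) G).
Proof.
move=> gC gc i1 i2; have [n0 hn0] := G_bd.
have G0 x : D x -> 0 < G x by move=> /D_clO[]; exact: G_gt0.
apply: (integral_cutoff_limit measurable_punctured measurable_G G0 (n0 := n0) i1 i2) => m n0m.
apply: green_truncated => //.
  by move=> x /hn0 h; rewrite (le_trans h)// ler_nat.
exact: (integrable_cutoff measurable_punctured measurable_G G0).
Qed.
End Profile.

Lemma G_gt0D x : D x -> 0 < G x.
Proof. by move=> /D_clO[]; exact: G_gt0. Qed.

Lemma powG_continuous a x : clO x -> x <> y -> {for x, continuous (fun z => G z `^ a)}.
Proof.
move=> cx xy; have c := powR_continuous (a := a) (G_gt0 cx xy).
have H := @continuous_comp _ _ _ G (fun t => t `^ a) x (G_continuous cx xy) c; exact: H.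
Qed.

Lemma measurable_powG a : measurable_fun D (fun x => G x `^ a).
Proof. by apply: measurable_D_continuous => x /D_clO[cx xy]; exact: powG_continuous. Qed.

Lemma measurable_gradG2 : measurable_fun D gradG2.
Proof. by apply: measurable_D_continuous => x /D_clO[cx xy]; exact: gradG2_continuous. Qed.

(** * Integrability of the power weights *)

Variables (e : R) (e0 : 0 < e).
Variables (u : M -> R) (hu2 : C2X X Omega u) (hu1 : C1Xbar X Omega u).

(** Up to the factor [(beta - 2) ^- 2] this is the weight of [u^2] in the theorem, see [weightE]. *)
Definition fundG (x : M) : R := G x `^ (- e - 1) * gradG2 x.

Lemma fundG_ge0 x : 0 <= fundG x.
Proof. by rewrite mulr_ge0 ?powR_ge0 ?gradG2_ge0. Qed.

Lemma measurable_fundG : measurable_fun D fundG.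
Proof. by apply: measurable_funM; [exact: measurable_powG|exact: measurable_gradG2]. Qed.

Lemma C1X_cst k : C1X X Omega (fun=> k).
Proof.
have [[_ ud] _ _] := hu1; split=> [x Ox|j x Ox]; first exact: cvg_cst.
split; first by exists 0; exact: is_Xder_cst (XderP (ud j x Ox).1).
rewrite /prop_for /continuous_at Xder_cst.
by rewrite (_ : Xder (X j) _ = cst 0); [exact: cvg_cst|apply/funext => z; rewrite Xder_cst].
Qed.

(* Integrating the divergence of [G^(-e) * cutoff(G)] times the gradient of [G] bounds the integral uniformly in the cutoff. *)
Lemma integrable_fundG : nu.-integrable D (EFin \o fundG).
Proof.
pose F (t : R) := t `^ (- e); pose dF (t : R) := - e * t `^ (- e - 1).
have hF x : clO x -> x <> y -> is_derive (G x) 1 F (dF (G x)) /\ {for G x, continuous dF}.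
  by move=> cx xy; exact: is_derive_powR_continuous (G_gt0 cx xy).
have [n0 hn0] := G_bd.
pose c := flux w X S (fun x => F (G x) * 1) (fun k => Xder (X k) G).
(* The integral of [q = (- e * cutoff + G * dcutoff) * fundG] is the flux [c]. As [dcutoff <= 0],
   [- q / e] is at least [cutoff * fundG], whence the bound [- c / e]. *)
apply: (integrable_of_cutoff measurable_punctured measurable_G (C := - c / e) (n0 := n0)).
- exact: measurable_fundG.
- by move=> x _; exact: fundG_ge0.
move=> m n0m; pose s : R := m.+1%:R; have s0 : 0 < s by [].
pose q x := cutoff s (G x) * (dF (G x) * 1 * gradG2 x + F (G x) * dotG (fun=> 1) x)
    + G x * dcutoff s (G x) * (F (G x) / G x * 1 * gradG2 x).
have dot0 x : dotG (fun=> 1) x = 0.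
  by rewrite /dotG big1// => k _; rewrite Xder_cst mul0r.
have qE x : D x -> q x = (- e * cutoff s (G x) + G x * dcutoff s (G x)) * fundG x.
  move=> Dx; rewrite /q dot0 /dF /F powR_divl ?G_gt0D// /fundG; ring.
have mq : measurable_fun D (fun x => (- e * cutoff s (G x) + G x * dcutoff s (G x)) * fundG x).
  apply: measurable_funM; last exact: measurable_fundG.
  apply: measurable_funD; apply: measurable_funM => //.
  - exact: measurable_cutoff measurable_G _.
  - exact: measurable_G.
  - exact: measurable_dcutoff measurable_G _.
(* [q] vanishes where [G > 2 * s] and is bounded on the remaining sublevel set: [e + 8] bounds the
   factor made of the cutoff and its derivative. *)
have [C hC] : exists C, forall x, clO x -> x <> y -> G x <= 2 * s -> `|fundG x| <= C.
  apply: bounded_sublevel => x cx xy.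
  by apply: cvgM; [exact: powG_continuous|exact: gradG2_continuous].
have qi' : nu.-integrable D (EFin \o (fun x => (- e * cutoff s (G x) + G x * dcutoff s (G x)) * fundG x)).
  apply: (integrable_bounded (C := (e + 8) * `|C|)) => // x Dx; have [cx xy] := D_clO Dx.
  have [Gs|Gs] := leP (G x) (2 * s); last first.
    have [-> ->] := cutoff_eq0 s0 (ltW Gs).
    by rewrite !mulr0 addr0 mul0r normr0 mulr_ge0// addr_ge0// ltW.
  rewrite normrM ler_pM//; last by rewrite (le_trans (hC x cx xy Gs))// ler_norm.
  rewrite (le_trans (ler_normD _ _))// lerD//.
    rewrite normrM normrN (gtr0_norm e0) ler_piMr ?(ltW e0)//.
    by rewrite ger0_norm ?cutoff_ge0 ?cutoff_le1.
  by apply: dcutoff_bound => //; exact/ltW/G_gt0D.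
have qi : nu.-integrable D (EFin \o q).
  apply: (eq_integrable measurable_punctured _ _ _ qi') => x; rewrite inE => Dx /=.
  by rewrite qE.
have hm x : bdO x -> G x <= m%:R by move=> /hn0 h; rewrite (le_trans h)// ler_nat.
have c1 : {within clO, continuous (fun=> 1 : R)} by apply: continuous_within => x _; exact: cvg_cst.
have := green_truncated hF hm (C1X_cst 1) c1 qi; rewrite -/c => qc.
have i1 : nu.-integrable D (EFin \o (fun x => (- e^-1) * q x)).
  by apply: integrable_scale => //; exact: measurable_punctured.
rewrite (_ : - c / e = \int[nu]_(x in D) ((- e^-1) * q x)); last first.
  by rewrite RintegralZl ?qc//; [ring|exact: measurable_punctured].
rewrite /Rintegral fineK; last exact: (integrable_fin_num measurable_punctured i1).
apply: ge0_le_integral.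
- exact: measurable_punctured.
- by move=> x _; rewrite lee_fin mulr_ge0 ?cutoff_ge0 ?fundG_ge0.
- apply/measurable_EFinP; apply: measurable_funM; last exact: measurable_fundG.
  exact: measurable_cutoff measurable_G _.
- exact: measurable_int i1.
move=> x Dx; rewrite lee_fin qE//.
have h : 0 <= - (e^-1 * (G x * dcutoff s (G x))).
  rewrite oppr_ge0 mulr_ge0_le0 ?invr_ge0 ?(ltW e0)// mulr_ge0_le0 ?dcutoff_le0//.
  exact/ltW/G_gt0D.
have -> : - e^-1 * ((- e * cutoff s (G x) + G x * dcutoff s (G x)) * fundG x) =
    (cutoff s (G x) + - (e^-1 * (G x * dcutoff s (G x)))) * fundG x.
  by field; rewrite gt_eqF.
by apply: ler_wpM2r; [exact: fundG_ge0|rewrite lerDl].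
Qed.

Lemma u_bounded : exists2 C, 0 <= C & forall x, Omega x ->
  `|u x| <= C /\ forall k, `|Xder (X k) u x| <= C.
Proof.
case: hu1 => _ uc uk.
have [C0 hC0] := compact_continuous_bounded compact_clO uc.
have /choice [C hC] : forall k, exists C, forall x, Omega x -> `|Xder (X k) u x| <= C.
  move=> k; have [g [gc gE]] := uk k.
  have [C hC] := compact_continuous_bounded compact_clO gc.
  by exists C => x Ox; rewrite -gE//; apply: hC; exact: subset_closure.
have Ck k : `|C k| <= \sum_j `|C j|.
  by rewrite (bigD1 k)//= lerDl sumr_ge0.
exists (`|C0| + \sum_k `|C k|); first by rewrite addr_ge0// sumr_ge0.
move=> x Ox; split=> [|k].
  rewrite (le_trans (hC0 _ (subset_closure Ox)))// (le_trans (ler_norm _))//.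
  by rewrite lerDl sumr_ge0.
by rewrite (le_trans (hC k x Ox))// (le_trans (ler_norm _))// (le_trans (Ck k))// lerDr.
Qed.

Lemma u_continuous x : Omega x -> {for (x : M), continuous u}.
Proof. by case: hu1 => -[h _] _ _; exact: h. Qed.

Lemma Xu_continuous k x : Omega x -> {for (x : M), continuous (Xder (X k) u)}.
Proof. by case: hu1 => -[_ h] _ _ Ox; exact: (h k x Ox).2. Qed.

Lemma measurable_u : measurable_fun D u.
Proof. by apply: measurable_D_continuous => x [Ox _]; exact: u_continuous. Qed.

Lemma measurable_Xu k : measurable_fun D (Xder (X k) u).
Proof. by apply: measurable_D_continuous => x [Ox _]; exact: Xu_continuous. Qed.

(** With the lower bound [c] of [G], the function is at most [c^(-e) * G]. *)
Lemma integrable_powG1 : nu.-integrable D (EFin \o (fun x => G x `^ (1 - e))).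
Proof.
have [c c0 hc] := G_min.
apply: (integrable_ler measurable_punctured (g := fun x => c `^ (- e) * G x)).
- exact: measurable_powG.
- move=> x Dx; have G0 := G_gt0D Dx; have [cx xy] := D_clO Dx.
  rewrite ger0_norm ?powR_ge0// -powR_mull// mulrC ler_wpM2r ?(ltW G0)//.
  by apply: powRN_le => //; [exact: hc|exact: ltW].
- by apply: integrable_scale; [exact: measurable_punctured|exact: integrable_G].
Qed.

(** From [a <= a^2 / G + G] with [a = |X_k G|], the function is dominated by [fundG + G^(1-e)]. *)
Lemma integrable_powG_XG k :
  nu.-integrable D (EFin \o (fun x => G x `^ (- e) * Xder (X k) G x)).
Proof.
apply: (integrable_ler measurable_punctured (g := fun x => fundG x + G x `^ (1 - e))).
- by apply: measurable_funM; [exact: measurable_powG|exact: measurable_XG].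
- move=> x Dx; have G0 := G_gt0D Dx.
  rewrite normrM ger0_norm ?powR_ge0// /fundG -powR_divl// -powR_mull//.
  have p0 := powR_gt0 (- e) G0.
  have aG : `|Xder (X k) G x| ^+ 2 <= gradG2 x.
    by rewrite real_normK ?num_real// /gradG2 (bigD1 k)//= lerDl sumr_ge0// => j _; exact: sqr_ge0.
  set a := `|_| in aG *; have a0 : 0 <= a by exact: normr_ge0.
  rewrite mulrAC (mulrC (G x)) -mulrA -mulrDr ler_pM2l//.
  apply: (@le_trans _ _ (a ^+ 2 / G x + G x)); last by rewrite lerD2r ler_pM2r ?invr_gt0.
  rewrite -(ler_pM2r G0) mulrDl divfK ?gt_eqF//.
  by nra.
- by apply: integrable_add; [exact: measurable_punctured|exact: integrable_fundG|exact: integrable_powG1].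
Qed.

Lemma integrable_gradU2 :
  nu.-integrable D (EFin \o (fun x => G x `^ (1 - e) * \sum_(k < N) Xder (X k) u x ^+ 2)).
Proof.
have [C C0 hC] := u_bounded.
rewrite (_ : (fun x => _) = (fun x => \sum_(k < N) Xder (X k) u x ^+ 2 * G x `^ (1 - e))); last first.
  by apply/funext => x; rewrite mulrC mulr_suml.
apply: integrable_sumr; first exact: measurable_punctured.
move=> k; apply: (@integrable_mul_bounded _ _ _ _ _ measurable_punctured (C ^+ 2)).
- by apply: measurable_funX; exact: measurable_Xu.
- move=> x [Ox _]; rewrite normrX ler_sqr ?nnegrE//; exact: (hC x Ox).2.
- exact: integrable_powG1.
Qed.

(** * Divergence formula for [F(G) u^2 grad G] *)

Section Weight.
Variables (F dF : R -> R) (C : R).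
Hypothesis hF : forall x, clO x -> x <> y ->
  is_derive (G x) 1 F (dF (G x)) /\ {for G x, continuous dF}.
Hypothesis hFC : forall x, D x -> `|F (G x)| <= C * G x `^ (- e).
Hypothesis hdFC : forall x, D x -> `|dF (G x)| <= C * G x `^ (- e - 1).

Lemma measurable_FG : measurable_fun D (fun x => F (G x)) /\ measurable_fun D (fun x => dF (G x)).
Proof.
split; apply: measurable_D_continuous => x /D_clO[cx xy]; have [d c] := hF cx xy.
  have Fc := is_derive_continuous d.
  have H := @continuous_comp _ _ _ G F x (G_continuous cx xy) Fc; exact: H.
have H := @continuous_comp _ _ _ G dF x (G_continuous cx xy) c; exact: H.
Qed.

Lemma integrable_weight_u2 :
  nu.-integrable D (EFin \o (fun x => dF (G x) * u x ^+ 2 * gradG2 x)).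
Proof.
have [Cu Cu0 hCu] := u_bounded; have [mF mdF] := measurable_FG.
apply: (integrable_ler measurable_punctured (g := fun x => C * Cu ^+ 2 * fundG x)).
- by apply: measurable_funM; [apply: measurable_funM => //; apply: measurable_funX; exact: measurable_u|exact: measurable_gradG2].
- move=> x Dx; have [Ox _] := Dx; rewrite normrM (ger0_norm (gradG2_ge0 x)) normrM normrX.
  rewrite [leRHS](_ : _ = C * G x `^ (- e - 1) * Cu ^+ 2 * gradG2 x); last by rewrite /fundG; ring.
  rewrite ler_wpM2r ?gradG2_ge0//.
  rewrite ler_pM ?exprn_ge0//; first exact: hdFC.
  by rewrite ler_sqr ?nnegrE//; exact: (hCu x Ox).1.
- by apply: integrable_scale; [exact: measurable_punctured|exact: integrable_fundG].
Qed.

Lemma integrable_weight_div_u2 :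
  nu.-integrable D (EFin \o (fun x => F (G x) / G x * u x ^+ 2 * gradG2 x)).
Proof.
have [Cu Cu0 hCu] := u_bounded; have [mF mdF] := measurable_FG.
apply: (integrable_ler measurable_punctured (g := fun x => C * Cu ^+ 2 * fundG x)).
- apply: measurable_funM; last exact: measurable_gradG2.
  apply: measurable_funM; last by apply: measurable_funX; exact: measurable_u.
  apply: measurable_funM => //; apply: measurable_D_continuous => x /D_clO[cx xy].
  by apply: cvgV; [rewrite gt_eqF// G_gt0|exact: G_continuous].
- move=> x Dx; have [Ox _] := Dx; rewrite normrM (ger0_norm (gradG2_ge0 x)) normrM normrX.
  rewrite [leRHS](_ : _ = C * G x `^ (- e - 1) * Cu ^+ 2 * gradG2 x); last by rewrite /fundG; ring.
  rewrite ler_wpM2r ?gradG2_ge0//.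
  have G0 := G_gt0D Dx.
  rewrite ler_pM ?exprn_ge0//; last by rewrite ler_sqr ?nnegrE//; exact: (hCu x Ox).1.
  rewrite normrM normfV (gtr0_norm G0) -powR_divl// mulrA ler_wpM2r ?invr_ge0 ?(ltW G0)//.
  exact: hFC.
- by apply: integrable_scale; [exact: measurable_punctured|exact: integrable_fundG].
Qed.

Lemma integrable_weight_dot :
  nu.-integrable D (EFin \o (fun x => F (G x) * u x * dotG u x)).
Proof.
have [Cu Cu0 hCu] := u_bounded; have [mF mdF] := measurable_FG.
rewrite (_ : (fun x => _) = (fun x => \sum_(k < N) (F (G x) * u x * Xder (X k) u x * Xder (X k) G x))); last first.
  by apply/funext => x; rewrite /dotG mulr_sumr; apply: eq_bigr => k _; rewrite mulrA.
apply: integrable_sumr; first exact: measurable_punctured.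
move=> k.
apply: (integrable_ler measurable_punctured (g := fun x => C * Cu ^+ 2 * `|G x `^ (- e) * Xder (X k) G x|)).
- apply: measurable_funM; last exact: measurable_XG.
  apply: measurable_funM; last exact: measurable_Xu.
  by apply: measurable_funM => //; exact: measurable_u.
- move=> x Dx; have [Ox _] := Dx; have [h1 h2] := hCu x Ox.
  rewrite !normrM (ger0_norm (powR_ge0 _ _)) mulrA ler_wpM2r// -!mulrA [leRHS](_ : _ = C * G x `^ (- e) * (Cu * Cu)); last by ring.
  rewrite ler_pM ?mulr_ge0//; first exact: hFC.
  by rewrite ler_pM//; exact: h2.
- apply: integrable_scale; first exact: measurable_punctured.
  by apply: integrable_norm; exact: integrable_powG_XG.
Qed.

(** This is [green_limit] for [g = u * u], whose gradient is [2 u grad u]. The bounds on [F] and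
    [dF] by powers of [G] cover both [G^(-e)] and its quotient by the logarithm. *)
Lemma green_weight :
  \int[nu]_(x in D) (dF (G x) * u x ^+ 2 * gradG2 x) +
  2 * \int[nu]_(x in D) (F (G x) * u x * dotG u x) =
  flux w X S (fun x => F (G x) * u x ^+ 2) (fun k => Xder (X k) G).
Proof.
have [uC uc _] := hu1.
have [gC gX] := C1X_mul open_domain uC uC.
have gc : {within clO, continuous (fun x => u x * u x)}.
  by apply/subspace_continuousP => x cx; apply: cvgM; move/subspace_continuousP : uc; exact.
have i1 := integrable_weight_u2.
have i2 : nu.-integrable D (EFin \o (fun x => 2 * (F (G x) * u x * dotG u x))).
  by apply: integrable_scale; [exact: measurable_punctured|exact: integrable_weight_dot].
have E x : D x -> dF (G x) * (u x * u x) * gradG2 x + F (G x) * dotG (fun x => u x * u x) x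
    = dF (G x) * u x ^+ 2 * gradG2 x + 2 * (F (G x) * u x * dotG u x).
  move=> [Ox _]; rewrite expr2; congr (_ + _); rewrite /dotG !mulr_sumr.
  by apply: eq_bigr => k _; rewrite (XderE (gX k x Ox)); ring.
rewrite -RintegralZl; [|exact: measurable_punctured|exact: integrable_weight_dot].
rewrite -RintegralD//; last exact: measurable_punctured.
rewrite (_ : flux _ _ _ _ _ = flux w X S (fun x => F (G x) * (u x * u x)) (fun k => Xder (X k) G)); last first.
  by congr flux; apply/funext => x; rewrite expr2.
rewrite -(green_limit hF gC gc).
- by apply: eq_Rintegral => x; rewrite inE => Dx; rewrite E.
- apply: (eq_integrable measurable_punctured _ _ _ (integrable_add measurable_punctured i1 i2)) => x.
  by rewrite inE => Dx /=; rewrite E.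
- apply: (eq_integrable measurable_punctured _ _ _ integrable_weight_div_u2) => x _ /=.
  by rewrite expr2.
Qed.
End Weight.

(** [bvalue] is a limit along [Omega], a proper filter at points of the closure, so any continuous
    extension computes it. *)
Lemma bvalueE (g h : M -> R) x : {within clO, continuous g} ->
  (forall z, Omega z -> g z = h z) -> clO x -> bvalue Omega h x = g x.
Proof.
move=> gc gh cx; have pf : ProperFilter (within (Omega : set M) (nbhs x)) by exact: within_nbhs_proper.
apply: cvg_lim => //; apply: (cvg_near_eq (F := within (Omega : set M) (nbhs x)) (g := g)).
  have H : \forall z \near x, Omega z -> h z = g z by apply: nearW => z Oz; rewrite gh.
  exact: H.
move/subspace_continuousP : gc => /(_ x cx) gc B /gc hB.
have {}hB : \forall z \near x, clO z -> B (g z) by exact: hB.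
by apply: filterS hB => z hz Oz; apply: hz; exact: subset_closure.
Qed.

(** * Divergence formula for [F(G) u grad u] *)

Section GreenXu.
Variables (F dF : R -> R).
Hypothesis hF : forall x, clO x -> x <> y ->
  is_derive (G x) 1 F (dF (G x)) /\ {for G x, continuous dF}.

Definition gradU2 (x : M) : R := \sum_(k < N) Xder (X k) u x ^+ 2.

(** [a] is the divergence of [F(G) u grad u], and [b] is the coefficient of [G * dcutoff] once the
    field is truncated. *)
Let a (x : M) : R := F (G x) * gradU2 x + F (G x) * u x * Lop X u x + dF (G x) * u x * dotG u x.
Let b (x : M) : R := F (G x) / G x * u x * dotG u x.

(** Plain admissibility applied to [f k = v * g k], with [v] the truncated [F(G) u] and [g k] a
    continuous extension of [X_k u] to the closure: admissibility asks for continuity up to the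
    boundary, where [X_k u] itself is not prescribed. *)
Lemma green_uXu_truncated (m : nat) : (forall x, bdO x -> G x <= m%:R) ->
  let q x := cutoff m.+1%:R (G x) * a x + G x * dcutoff m.+1%:R (G x) * b x in
  nu.-integrable D (EFin \o q) ->
  \int[nu]_(x in D) q x =
  flux w X S (fun x => F (G x) * u x) (fun k => bvalue Omega (Xder (X k) u)).
Proof.
move=> hm q qi; pose s : R := m.+1%:R; have s0 : 0 < s by [].
have [uC uc uk] := hu1; have [_ uC2] := hu2.
have /choice [g hg] := uk.
have gc k : {within clO, continuous (g k)} by case: (hg k).
have gE k x : Omega x -> g k x = Xder (X k) u x by case: (hg k) => _; exact.
have ngE k x : Omega x -> \forall z \near (x : M), g k z = Xder (X k) u z.
  move=> Ox; have nO : \forall z \near (x : M), Omega z.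
    by apply: open_nbhs_nbhs; split=> //; exact: open_domain.
  by apply: filterS nO => z; exact: gE.
have gC k : C1X X Omega (g k).
  by apply: C1X_near_eq open_domain _ (uC2 k) => x Ox; rewrite gE.
have [pC pX] := profile_C1X hF s0 uC.
pose v x := profile F s x * u x.
have [vC vX] := C1X_mul open_domain pC uC.
have vc x : clO x -> v @ within clO (nbhs x) --> v x.
  move=> cx; apply: cvgM.
    exact: cvg_within_filter (profile_continuous hF s0 cx).
  by move/subspace_continuousP : uc; exact.
pose f k x := v x * g k x.
have fc k : {within clO, continuous (f k)}.
  apply/subspace_continuousP => x cx; apply: cvgM; first exact: vc.
  by move/subspace_continuousP : (gc k); exact.
have fC k : C1X X Omega (f k) by have [] := C1X_mul open_domain vC (gC k).
have fD x : D x -> \sum_(k < N) Xder (X k) (f k) x = q x.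
  move=> Dx; have [cx xy] := D_clO Dx; have [Ox _] := Dx.
  have G0 : G x != 0 by rewrite gt_eqF// G_gt0.
  have -> : q x = cutoff s (G x) * F (G x) * gradU2 x
      + cutoff s (G x) * F (G x) * u x * Lop X u x
      + (cutoff s (G x) * dF (G x) + F (G x) * dcutoff s (G x)) * u x * dotG u x.
    by rewrite /q /a /b -/s; field.
  rewrite /gradU2 /Lop /dotG !mulr_sumr -!big_split; apply: eq_bigr => k _ /=.
  have [_ fX] := C1X_mul open_domain vC (gC k).
  rewrite (XderE (fX k x Ox)) (XderE (vX k x Ox)) (XderE (pX k x Dx)).
  by rewrite (near_eq_Xder (X k) (ngE k x Ox)) gE// /v profile_eq//; ring.
have fi : nu.-integrable D (EFin \o fun x => \sum_(k < N) Xder (X k) (f k) x).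
  apply: (eq_integrable measurable_punctured (EFin \o q)) => // x; rewrite inE => Dx /=.
  by rewrite fD.
have [fiO fiE] := integrable_domain fi.
case: hOmega => -[_ _ hS /(_ f (fun k => conj (fC k) (fc k)) fiO)] + _ _ _.
rewrite [LHS]fiE => E.
have <- : \sum_(k < N) single_flux w X S k (f k) =
    flux w X S (fun x => F (G x) * u x) (fun k => bvalue Omega (Xder (X k) u)).
  rewrite -(@fluxE _ _ _ _ w _ _ _ _ hS v g)//.
  apply: (@eq_flux _ _ _ _ w _ _ _ _ hS) => x k bx; have [cx xy] := bd_clO bx.
  rewrite (bvalueE (gc k) (gE k) cx) /v profile_eq// (cutoff_eq1 s0 _).1 ?mul1r//.
  by rewrite (le_trans (hm _ bx))// ler_nat.
apply: EFin_inj; rewrite -E /Rintegral fineK; last exact: (integrable_fin_num measurable_punctured qi).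
by apply: eq_integral => x; rewrite inE => Dx; congr EFin; exact: esym (fD x Dx).
Qed.

Lemma green_uXu_limit :
  nu.-integrable D (EFin \o (fun x => F (G x) * gradU2 x)) ->
  nu.-integrable D (EFin \o (fun x => F (G x) * u x * Lop X u x)) ->
  nu.-integrable D (EFin \o (fun x => dF (G x) * u x * dotG u x)) ->
  nu.-integrable D (EFin \o b) ->
  \int[nu]_(x in D) (F (G x) * gradU2 x) + \int[nu]_(x in D) (F (G x) * u x * Lop X u x)
    + \int[nu]_(x in D) (dF (G x) * u x * dotG u x) =
  flux w X S (fun x => F (G x) * u x) (fun k => bvalue Omega (Xder (X k) u)).
Proof.
move=> i1 i2 i3 i4; have [n0 hn0] := G_bd; have mD := measurable_punctured.
have i12 := integrable_add mD i1 i2.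
have ia : nu.-integrable D (EFin \o a) := integrable_add mD i12 i3.
rewrite -!RintegralD//.
have := integral_cutoff_limit mD measurable_G G_gt0D (n0 := n0) ia i4; apply => m n0m.
apply: green_uXu_truncated.
  by move=> x /hn0 h; rewrite (le_trans h)// ler_nat.
exact: (integrable_cutoff mD measurable_G G_gt0D).
Qed.
End GreenXu.

(** * The weights of the theorem and the Hardy inequality *)

Section Rellich.
Variables (alpha beta K : R).
Hypotheses (hab : alpha < beta) (hba : 4 - beta < alpha) (hb : 2 < beta).
Hypothesis he : e = (beta + alpha - 4) / (beta - 2).
Let r : R := (2 - beta)^-1.
Let d (x : M) : R := G x `^ (2 - beta)^-1.
Hypothesis hK : ((expR 1)%:E * ereal_sup [set (d x)%:E | x in (Omega `\ y)%classic] <= K%:E)%E.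

Let b2 : 2 - beta != 0. Proof. by rewrite subr_eq0 lt_eqF. Qed.
Let b2' : beta - 2 != 0. Proof. by rewrite subr_eq0 gt_eqF. Qed.

Lemma gradX_dE x : D x -> gradX_sqr X d x = r ^+ 2 * G x `^ ((r - 1) + (r - 1)) * gradG2 x.
Proof.
move=> Dx; have [cx xy] := D_clO Dx; have G0 := G_gt0 cx xy.
rewrite /gradX_sqr /gradG2 mulr_sumr; apply: eq_bigr => k _.
have dX := is_Xder_comp (is_derive1_powR r G0) (XderP (G_Xder k cx xy).1).
by rewrite (XderE dX) -(powR_add (r - 1) (r - 1) G0); ring.
Qed.

Lemma weightE x : D x ->
  G x `^ ((alpha - 4) / (2 - beta)) * gradX_sqr X d x = (beta - 2) ^- 2 * fundG x.
Proof.
move=> Dx; have G0 := G_gt0D Dx; rewrite gradX_dE// /fundG.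
have -> : - e - 1 = (alpha - 4) / (2 - beta) + ((r - 1) + (r - 1)).
  by rewrite he /r; field; rewrite b2 b2'.
rewrite -(powR_add ((alpha - 4) / (2 - beta)) (r - 1 + (r - 1)) G0).
have -> : r ^+ 2 = (beta - 2) ^- 2 by rewrite /r -[beta - 2]opprB sqrrN exprVn.
ring.
Qed.

(** The bound is given on the punctured domain and passes to the closure by continuity: the set
    where it fails, with the pole removed, is open and would meet [Omega]. *)
Lemma exp1_d_le x : clO x -> x <> y -> expR 1 * d x <= K.
Proof.
have hD z : D z -> expR 1 * d z <= K.
  move=> Dz; rewrite -lee_fin EFinM; apply: le_trans hK.
  by apply: lee_wpmul2l; [rewrite lee_fin expR_ge0|apply: ereal_sup_ubound; exists z].
move=> cx xy; rewrite leNgt; apply/negP => lt.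
have dc : {for x, continuous (fun z => expR 1 * d z)}.
  by apply: cvgM; [exact: cvg_cst|exact: powG_continuous].
have nK : \forall a \near expR 1 * d x, K < a by exact: lt_nbhsr.
have nlt : \forall z \near x, K < expR 1 * d z by exact: (dc _ nK).
have [z [Oz [hz zy]]] : (Omega : set M) `&` [set z | K < expR 1 * d z /\ z <> y] !=set0.
  apply: cx; exact: filterS2 nlt (near_neq xy) => z h1 h2.
by have := hD z (conj Oz zy); rewrite leNgt hz.
Qed.

(** [ln (K / d)] as a function of the value [t] of [G], so that it can enter a profile [F]. *)
Definition logdist (t : R) : R := ln K - r * ln t.

Lemma logdistE x : clO x -> x <> y -> ln (K / d x) = logdist (G x).
Proof.
move=> cx xy; have G0 := G_gt0 cx xy.
have d0 : 0 < d x by exact: powR_gt0.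
have K0 : 0 < K.
  by apply: lt_le_trans (exp1_d_le cx xy); rewrite mulr_gt0// expR_gt0.
by rewrite ln_div ?posrE// /d ln_powR.
Qed.

(** The factor [expR 1] in the bound on [K] acts here: [K / d] is at least e, so inverse powers of
    the logarithm are at most 1. *)
Lemma logdist_ge1 x : clO x -> x <> y -> 1 <= logdist (G x).
Proof.
move=> cx xy; rewrite -logdistE//; have G0 := G_gt0 cx xy.
have d0 : 0 < d x by exact: powR_gt0.
have h := exp1_d_le cx xy.
rewrite -[1](expRK 1) ler_ln ?posrE ?expR_gt0//; first by rewrite ler_pdivlMr.
by rewrite divr_gt0//; apply: lt_le_trans h; rewrite mulr_gt0// expR_gt0.
Qed.

(** [F1] yields the boundary term [B], [F2] the logarithmic one [Blog], and [F3] is the weight of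
    [|grad u|^2]. *)
Let F1 (t : R) : R := t `^ (- e).
Let dF1 (t : R) : R := - e * t `^ (- e - 1).
Let F2 (t : R) : R := t `^ (- e) * (logdist t)^-1.
Let dF2 (t : R) : R := t `^ (- e) * (- (logdist t) ^- 2 * - (r / t))
  + (logdist t)^-1 * (- e * t `^ (- e - 1)).
Let F3 (t : R) : R := t `^ (1 - e).
Let dF3 (t : R) : R := (1 - e) * t `^ (1 - e - 1).

Lemma is_derive_weight1 x : clO x -> x <> y -> is_derive (G x) 1 F1 (dF1 (G x)) /\ {for G x, continuous dF1}.
Proof. by move=> cx xy; exact: is_derive_powR_continuous (G_gt0 cx xy). Qed.

Lemma is_derive_weight3 x : clO x -> x <> y -> is_derive (G x) 1 F3 (dF3 (G x)) /\ {for G x, continuous dF3}.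
Proof. by move=> cx xy; exact: is_derive_powR_continuous (G_gt0 cx xy). Qed.

Lemma is_derive_logdist (t : R) : 0 < t -> is_derive t 1 logdist (- (r / t)).
Proof.
move=> t0; have := is_deriveB (is_derive_cst (ln K) t 1) (is_deriveZ r (is_derive1_ln t0)).
by rewrite sub0r.
Qed.

Lemma is_derive_weight2 x : clO x -> x <> y -> is_derive (G x) 1 F2 (dF2 (G x)) /\ {for G x, continuous dF2}.
Proof.
move=> cx xy; have G0 := G_gt0 cx xy.
have L0 : logdist (G x) != 0 by rewrite gt_eqF// (lt_le_trans ltr01)// logdist_ge1.
have dL := is_derive_logdist G0.
have Lc := is_derive_continuous dL.
have [d1 c1] := is_derive_weight1 cx xy.
split; first exact: (is_deriveM d1 (is_deriveV L0 dL)).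
have Lic : {for G x, continuous (fun t => (logdist t)^-1)} by exact: (cvgV L0 Lc).
apply: cvgD; apply: cvgM => //.
  exact: powR_continuous.
apply: cvgM; apply: cvgN.
  apply: cvgV; first by rewrite expf_neq0.
  by rewrite expr2; apply: cvgM.
by apply: cvgM; [exact: cvg_cst|apply: cvgV; [rewrite gt_eqF|exact: cvg_id]].
Qed.

Let a : R := beta + alpha - 4.
Let a0 : 0 < a. Proof. by rewrite /a; have := hba; lra. Qed.
Let er : e = - a * r.
Proof. by rewrite he /r /a; field; rewrite b2 b2'. Qed.

(** [green_weight] takes one constant for a profile and its derivative: [1 + e] for [F1], and
    [1 + (e + |r|)] for [F2]. *)
Lemma weight1_le x : D x -> `|F1 (G x)| <= (1 + e) * G x `^ (- e).
Proof.
move=> Dx; rewrite ger0_norm ?powR_ge0// ler_peMl ?powR_ge0// lerDl; exact: ltW.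
Qed.

Lemma dweight1_le x : D x -> `|dF1 (G x)| <= (1 + e) * G x `^ (- e - 1).
Proof.
move=> Dx; rewrite normrM normrN (gtr0_norm e0) (ger0_norm (powR_ge0 _ _)).
by rewrite ler_wpM2r ?powR_ge0// lerDr.
Qed.

Lemma weight2_le x : D x -> `|F2 (G x)| <= (1 + (e + `|r|)) * G x `^ (- e).
Proof.
move=> /D_clO[cx xy]; have L1 := logdist_ge1 cx xy; have L0 := lt_le_trans ltr01 L1.
rewrite normrM ger0_norm ?powR_ge0// mulrC ler_wpM2r ?powR_ge0//.
rewrite (@le_trans _ _ 1)//; first by rewrite gtr0_norm ?invr_gt0// invf_le1.
by rewrite lerDl addr_ge0// ltW.
Qed.

Lemma dweight2_le x : D x -> `|dF2 (G x)| <= (1 + (e + `|r|)) * G x `^ (- e - 1).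
Proof.
move=> /D_clO[cx xy]; have L1 := logdist_ge1 cx xy; have L0 := lt_le_trans ltr01 L1.
have G0 := G_gt0 cx xy.
have Li : 0 < (logdist (G x))^-1 <= 1 by rewrite invr_gt0 L0 invf_le1.
have Li2 : (logdist (G x)) ^- 2 <= 1 by rewrite -exprVn expr_le1//; case/andP: Li => /ltW.
have Li20 : 0 <= (logdist (G x)) ^- 2 by rewrite -exprVn sqr_ge0.
case/andP: Li => Li0 Li1.
have z0 := powR_ge0 (G x) (- e - 1); have r0 := normr_ge0 r.
have -> : dF2 (G x) = G x `^ (- e - 1) * ((logdist (G x)) ^- 2 * r - e * (logdist (G x))^-1).
  by rewrite /dF2 -powR_divl//; field; rewrite !gt_eqF.
rewrite normrM ger0_norm// mulrC ler_wpM2r//.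
rewrite (le_trans (ler_normB _ _))// !normrM (ger0_norm Li20) (gtr0_norm e0) (gtr0_norm Li0).
by have := ltW e0; nra.
Qed.

Let kap : R := (beta - 2) ^- 2.
Let kapr : kap = r ^+ 2. Proof. by rewrite /kap /r -[beta - 2]opprB sqrrN exprVn. Qed.

(** On [D], [Wu] and [q6] are the integrands of the two [u^2] integrals of the theorem. [q2] and
    [q3] are the cross terms for [F1] and [F2]; [q4] and [q5] contain the derivatives of these
    profiles. *)
Let Wu (x : M) : R := kap * fundG x * u x ^+ 2.
Let q1 (x : M) : R := F3 (G x) * gradU2 x.
Let q2 (x : M) : R := F1 (G x) * u x * dotG u x.
Let q3 (x : M) : R := F2 (G x) * u x * dotG u x.
Let q4 (x : M) : R := dF1 (G x) * u x ^+ 2 * gradG2 x.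
Let q5 (x : M) : R := dF2 (G x) * u x ^+ 2 * gradG2 x.
Let q6 (x : M) : R := Wu x * (logdist (G x)) ^- 2.
Let rhoLu (x : M) : R := F3 (G x) * u x * Lop X u x.

Let i1 : nu.-integrable D (EFin \o q1). Proof. exact: integrable_gradU2. Qed.
Let i2 : nu.-integrable D (EFin \o q2). Proof. exact: integrable_weight_dot is_derive_weight1 weight1_le. Qed.
Let i3 : nu.-integrable D (EFin \o q3). Proof. exact: integrable_weight_dot is_derive_weight2 weight2_le. Qed.
Let i4 : nu.-integrable D (EFin \o q4). Proof. exact: integrable_weight_u2 is_derive_weight1 dweight1_le. Qed.
Let i5 : nu.-integrable D (EFin \o q5). Proof. exact: integrable_weight_u2 is_derive_weight2 dweight2_le. Qed.

Let q4E x : q4 x = - a * (beta - 2) * Wu x.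
Proof. by rewrite /q4 /Wu /kap /fundG /dF1 he /a; field. Qed.

Lemma integrable_Wu : nu.-integrable D (EFin \o Wu).
Proof.
have -> : Wu = (fun x => (- (a * (beta - 2))^-1) * q4 x).
  by apply/funext => x; rewrite q4E; field; rewrite b2' gt_eqF.
by apply: integrable_scale; [exact: measurable_punctured|exact: i4].
Qed.

Let i6 : nu.-integrable D (EFin \o q6).
Proof.
have -> : q6 = (fun x => (logdist (G x)) ^- 2 * Wu x) by apply/funext => x; rewrite mulrC.
apply: (@integrable_mul_bounded _ _ _ _ _ measurable_punctured 1).
- apply: measurable_D_continuous => x /D_clO[cx xy].
  have L0 : logdist (G x) != 0 by rewrite gt_eqF// (lt_le_trans ltr01)// logdist_ge1.
  have Lc := is_derive_continuous (is_derive_logdist (G_gt0 cx xy)).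
  have Lx := @continuous_comp _ _ _ G logdist x (G_continuous cx xy) Lc.
  by apply: cvgV; [rewrite expf_neq0|rewrite expr2; exact: cvgM].
- move=> x /D_clO[cx xy]; have L1 := logdist_ge1 cx xy; have L0 := lt_le_trans ltr01 L1.
  by rewrite ger0_norm -?exprVn ?sqr_ge0// expr_le1 ?invr_ge0 ?(ltW L0)// invf_le1.
- exact: integrable_Wu.
Qed.

Let J := \int[nu]_(x in D) Wu x.
Let J2 := \int[nu]_(x in D) q6 x.
Let P := \int[nu]_(x in D) q2 x.
Let B := flux w X S (fun x => F1 (G x) * u x ^+ 2) (fun k => Xder (X k) G).
Let Blog := flux w X S (fun x => F2 (G x) * u x ^+ 2) (fun k => Xder (X k) G).
Let Phi := flux w X S (fun x => F3 (G x) * u x) (fun k => bvalue Omega (Xder (X k) u)).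

Lemma green_B : - a * (beta - 2) * J + 2 * P = B.
Proof.
rewrite /B -(green_weight is_derive_weight1 weight1_le dweight1_le) -/P; congr (_ + _).
rewrite /J -RintegralZl; [|exact: measurable_punctured|exact: integrable_Wu].
by apply: eq_Rintegral => x _; rewrite -/(q4 x) q4E.
Qed.

Lemma green_Blog : \int[nu]_(x in D) q5 x + 2 * \int[nu]_(x in D) q3 x = Blog.
Proof. exact: green_weight is_derive_weight2 weight2_le dweight2_le. Qed.

(* The square [|grad u + (a/2 + s / log) u (grad d) / d|^2] integrated against the weight. *)
Lemma hardy (s : R) : a / (2 * (beta - 2)) * B + a ^+ 2 / 4 * J + s / (beta - 2) * Blog
    + (s - s ^+ 2) * J2 <= \int[nu]_(x in D) q1 x.
Proof.
pose tot x := a * r * q2 x + (2 * s * r * q3 x + (a ^+ 2 / 4 * Wu x +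
  ((s ^+ 2 - s) * q6 x + (s * r * q5 x + q1 x)))).
have mD := measurable_punctured.
have tot0 x : D x -> 0 <= tot x.
  move=> Dx; have [cx xy] := D_clO Dx; have G0 := G_gt0 cx xy.
  have L0 : logdist (G x) != 0 by rewrite gt_eqF// (lt_le_trans ltr01)// logdist_ge1.
  have Gn : G x != 0 by rewrite gt_eqF.
  pose z := G x `^ (- e - 1); have z0 : 0 <= z by exact: powR_ge0.
  have zE : G x `^ (- e) = z * G x by rewrite /z -powR_divl// divfK.
  have zE3 : G x `^ (1 - e) = z * G x * G x by rewrite -powR_mull// zE mulrC.
  (* Here [r * grad G / G] is [(grad d) / d]. The derivative of the inverse logarithm inside [q5]
     adds [s] to the coefficient [s^2 - s] of [q6], and this completes the square. *)
  suff -> : tot x = z * \sum_(k < N) (G x * Xder (X k) u x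
      + (a / 2 + s / logdist (G x)) * r * u x * Xder (X k) G x) ^+ 2.
    by rewrite mulr_ge0// sumr_ge0// => k _; exact: sqr_ge0.
  rewrite /tot /q2 /q3 /q6 /q5 /q1 /Wu kapr /F1 /F2 /dF2 /F3 /fundG zE zE3 -/z er.
  (* Sorting by [gradG2], [dotG] and [gradU2] allows the identity to be checked for each [k]
     separately. *)
  pose A3 := (a ^+ 2 / 4 * r ^+ 2 * z + (s ^+ 2 - s) * r ^+ 2 * z * logdist (G x) ^- 2
    + s * r * (z * G x * (logdist (G x) ^- 2 * (r / G x)) + a * r * z / logdist (G x))) * u x ^+ 2.
  pose A2 := (a * r * z * G x + 2 * s * r * z * G x / logdist (G x)) * u x.
  transitivity (A3 * gradG2 x + (A2 * dotG u x + z * G x * G x * gradU2 x)).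
    by rewrite /A2 /A3; field; rewrite Gn L0.
  rewrite /gradG2 /dotG /gradU2 !mulr_sumr -!big_split; apply: eq_bigr => k _ /=.
  by rewrite /A2 /A3; field; rewrite Gn L0.
have H : 0 <= \int[nu]_(x in D) tot x by exact: Rintegral_ge0.
have [j5 E5] := Rintegral_axpy mD (s * r) i5 i1.
have [j6 E6] := Rintegral_axpy mD (s ^+ 2 - s) i6 j5.
have [jW EW] := Rintegral_axpy mD (a ^+ 2 / 4) integrable_Wu j6.
have [j3 E3] := Rintegral_axpy mD (2 * s * r) i3 jW.
have [j2 E2] := Rintegral_axpy mD (a * r) i2 j3.
move: H; rewrite /tot E2 E3 EW E6 E5 -/J -/J2 -/P => H.
rewrite -green_Blog -green_B -subr_ge0; apply: (le_trans H).
rewrite le_eqVlt; apply/orP; left; apply/eqP.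
by rewrite /r; field; rewrite b2 b2'.
Qed.

(** Extended-real valued: the inverse is [+oo] where the gradient of [d] vanishes, and the product
    is 0 there if [L u] vanishes too. *)
Let energy (x : M) : \bar R :=
  ((G x `^ (alpha / (2 - beta)))%:E * (gradX_sqr X d x)%:E^-1 * (`|Lop X u x| ^+ 2)%:E)%E.

Lemma gradX_ge0 x : 0 <= gradX_sqr X d x.
Proof. by apply: sumr_ge0 => k _; exact: sqr_ge0. Qed.

Lemma energy_ge0 x : (0 <= energy x)%E.
Proof.
by rewrite /energy !mule_ge0 ?inve_ge0 ?lee_fin ?powR_ge0 ?gradX_ge0 ?exprn_ge0.
Qed.

(** Pointwise Cauchy-Schwarz with a parameter: after multiplication by [g], the difference of the
    two sides is a square. *)
Lemma energy_ge (c : R) x : D x -> ((2 * c * rhoLu x - c ^+ 2 * Wu x)%:E <= energy x)%E.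
Proof.
move=> Dx; have G0 := G_gt0D Dx.
rewrite /Wu -/kap -weightE// /energy inver.
set g := gradX_sqr X d x; have g0 : 0 <= g by exact: gradX_ge0.
(* Where the gradient of [d] vanishes so does the [u^2] term; then either [L u = 0] and both sides
   are 0, or the right-hand side is [+oo]. *)
have [gz|gn] := eqVneq g 0.
  rewrite gz !(mulr0, mul0r) subr0.
  have [Lz|Ln] := eqVneq (Lop X u x) 0.
    by rewrite /rhoLu Lz !mulr0 normr0 expr0n/= mule0.
  by rewrite gt0_muley ?lte_fin ?powR_gt0// gt0_mulye ?leey// lte_fin exprn_gt0// normr_gt0.
have gp : 0 < g by rewrite lt_def gn.
rewrite -!EFinM lee_fin real_normK ?num_real//.
(* [p] and [q] are the square roots of the two weights; the mean of their exponents is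
   [(alpha - 2) / (2 - beta) = 1 - e], so [p * q] is [F3(G)]. *)
pose p := G x `^ (alpha / (2 - beta) / 2); pose q := G x `^ ((alpha - 4) / (2 - beta) / 2).
have pE : G x `^ (alpha / (2 - beta)) = p ^+ 2.
  by rewrite /p expr2 powR_add//; congr (_ `^ _); field.
have qE : G x `^ ((alpha - 4) / (2 - beta)) = q ^+ 2.
  by rewrite /q expr2 powR_add//; congr (_ `^ _); field.
have pqE : F3 (G x) = p * q.
  by rewrite /F3 /p /q powR_add//; congr (_ `^ _); rewrite he; field; rewrite b2 b2'.
rewrite /rhoLu pE qE pqE -(ler_pM2r gp) -subr_ge0.
set l := Lop X u x.
suff -> : p ^+ 2 / g * l ^+ 2 * g - (2 * c * (p * q * u x * l) - c ^+ 2 * (q ^+ 2 * g * u x ^+ 2)) * g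
    = (p * l - c * q * g * u x) ^+ 2 by exact: sqr_ge0.
by field.
Qed.

Lemma gradX_continuous x : D x -> {for (x : M), continuous (gradX_sqr X d)}.
Proof.
move=> Dx; have [cx xy] := D_clO Dx.
rewrite /prop_for /continuous_at gradX_dE//.
apply: (cvg_near_eq (F := nbhs (x : M)) (g := fun z => r ^+ 2 * G z `^ ((r - 1) + (r - 1)) * gradG2 z)).
  have nD : \forall z \near (x : M), D z by apply: open_nbhs_nbhs; split=> //; exact: open_punctured.
  by apply: filterS nD => z; exact: gradX_dE.
apply: cvgM; last exact: gradG2_continuous.
by apply: cvgM; [exact: cvg_cst|exact: powG_continuous].
Qed.

Lemma measurable_Lu : measurable_fun D (Lop X u).
Proof.
apply: measurable_D_continuous => x [Ox _]; apply: (cvg_sumr (F := nbhs (x : M))) => k.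
by case: hu2 => _ /(_ k)[_ h]; exact: (h k x Ox).2.
Qed.

(** The extended inverse is a case distinction: constant where the gradient of [d] vanishes,
    continuous on the open set where it does not. *)
Lemma measurable_energy : measurable_fun D (energy : borel M -> \bar R).
Proof.
apply: emeasurable_funM; last first.
  apply/measurable_EFinP; apply: measurable_funX; apply: measurableT_comp => //.
  exact: measurable_Lu.
apply: emeasurable_funM; first by apply/measurable_EFinP; exact: measurable_powG.
under eq_fun do rewrite inver.
have oU : open [set x : M | D x /\ gradX_sqr X d x != 0].
  rewrite openE => x [Dx gx].
  have n0 : \forall t \near gradX_sqr X d x, t != 0.
    by apply: open_nbhs_nbhs; split=> //; exact: open_neq.
  have nD : \forall z \near (x : M), D z by apply: open_nbhs_nbhs; split=> //; exact: open_punctured.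
  have ng : \forall z \near (x : M), gradX_sqr X d z != 0 by exact: (gradX_continuous Dx n0).
  exact: filterS2 nD ng.
have eqU : D `&` (fun x => gradX_sqr X d x == 0) @^-1` [set false] = [set x : borel M | D x /\ gradX_sqr X d x != 0].
  by apply/seteqP; split=> x /= [Dx h]; split=> //; [rewrite h|exact/negbTE].
apply: measurable_fun_if.
- exact: measurable_punctured.
- by apply: (measurable_fun_bool false); rewrite eqU; exact: borel_open.
- exact: measurable_cst.
- rewrite eqU; apply/measurable_EFinP; apply: borel_continuous => // x [Dx gx].
  by apply: cvgV => //; exact: gradX_continuous.
Qed.

(** * The Rellich inequality for a finite left-hand side *)

Section FiniteEnergy.
Hypothesis energy_fin : (\int[nu]_(x in Omega) energy x < +oo)%E.

Lemma integrable_energy : nu.-integrable D energy.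
Proof.
apply/integrableP; split; first exact: measurable_energy.
rewrite (_ : (\int[nu]_(x in D) `|energy x| = \int[nu]_(x in D) energy x)%E); last first.
  by apply: eq_integral => x _; rewrite gee0_abs// energy_ge0.
by rewrite -(ge0_integral_domain measurable_energy energy_ge0).
Qed.

(** [energy_ge] with [c = 1] and [c = -1], according to the sign of [rhoLu], bounds its absolute
    value by [energy + Wu]. *)
Lemma integrable_rhoLu : nu.-integrable D (EFin \o rhoLu).
Proof.
have mD := measurable_punctured.
apply: (le_integrable mD (g := (energy \+ (EFin \o Wu))%E)).
- apply/measurable_EFinP; apply: measurable_funM; last exact: measurable_Lu.
  by apply: measurable_funM; [exact: measurable_powG|exact: measurable_u].
- move=> x Dx; have W0 : 0 <= Wu x.
    by rewrite /Wu kapr; apply: mulr_ge0; [apply: mulr_ge0; [exact: sqr_ge0|exact: fundG_ge0]|exact: sqr_ge0].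
  rewrite [leRHS]gee0_abs; last by rewrite adde_ge0// energy_ge0.
  rewrite -leeBlDr// /= -EFinB.
  have h1 := energy_ge 1 Dx; have h2 := energy_ge (-1) Dx.
  have [s0|s0] := leP 0 (rhoLu x).
    by apply: le_trans h1; rewrite lee_fin ger0_norm//; lra.
  by apply: le_trans h2; rewrite lee_fin ltr0_norm//; lra.
- apply: integrableD => //; first exact: integrable_energy.
  exact: integrable_Wu.
Qed.

(** [F3] has derivative [(1 - e) * F1] and [F3(t) / t = F1(t)], so the remaining terms of
    [green_uXu_limit] are multiples of [q2]. *)
Lemma green_Phi : \int[nu]_(x in D) q1 x + \int[nu]_(x in D) rhoLu x + (1 - e) * P = Phi.
Proof.
have j3E x : D x -> dF3 (G x) * u x * dotG u x = (1 - e) * q2 x.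
  by move=> Dx; rewrite /dF3 /q2 /F1 (_ : 1 - e - 1 = - e); ring.
have j3 : nu.-integrable D (EFin \o (fun x => dF3 (G x) * u x * dotG u x)).
  apply: (eq_integrable measurable_punctured _ _ _ (integrable_scale measurable_punctured (1 - e) i2)) => x.
  by rewrite inE => Dx /=; rewrite j3E.
have j4 : nu.-integrable D (EFin \o (fun x => F3 (G x) / G x * u x * dotG u x)).
  apply: (eq_integrable measurable_punctured _ _ _ i2) => x; rewrite inE => Dx /=.
  by rewrite /F3 powR_divl ?G_gt0D// /q2 /F1 (_ : 1 - e - 1 = - e)//; ring.
have E := green_uXu_limit is_derive_weight3 i1 integrable_rhoLu j3 j4.
rewrite /Phi -E; congr (_ + _); rewrite /P -RintegralZl; [|exact: measurable_punctured|exact: i2].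
by apply: eq_Rintegral => x; rewrite inE => Dx; rewrite j3E.
Qed.

(** [energy_ge] at [- c] is integrated, [green_Phi] and [green_B] eliminate [rhoLu] and [P], and
    [hardy] times [2 * c] bounds the integral of [q1]. The coefficient of [J] becomes
    [c * a * (beta - alpha) / 2 - c^2]; the chosen [c] maximizes it, with maximum [c^2]. *)
Lemma rellich (s : R) (c := a * (beta - alpha) / 4) :
  ((c ^+ 2 * J + 2 * c * (s - s ^+ 2) * J2 + 2 * c * s / (beta - 2) * Blog + c * a / (beta - 2) * B
   + c * ((1 - e) * B - 2 * Phi))%:E <= \int[nu]_(x in Omega) energy x)%E.
Proof.
rewrite (ge0_integral_domain measurable_energy energy_ge0).
have mD := measurable_punctured.
have [ji E] := Rintegral_axpy mD (- c ^+ 2) integrable_Wu (integrable_scale mD (- 2 * c) integrable_rhoLu).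
have : ((\int[nu]_(x in D) (- c ^+ 2 * Wu x + - 2 * c * rhoLu x))%:E <= \int[nu]_(x in D) energy x)%E.
  rewrite /Rintegral fineK; last exact: (integrable_fin_num mD ji).
  apply: (le_integral mD ji integrable_energy) => x; rewrite inE => Dx /=.
  by apply: le_trans (energy_ge (- c) Dx); rewrite lee_fin; lra.
apply: le_trans; rewrite lee_fin E RintegralZl//; last exact: integrable_rhoLu.
rewrite -/J.
have c0 : 0 <= c by rewrite /c mulr_ge0// mulr_ge0 ?(ltW a0)// subr_ge0 ltW.
have H1 := hardy s; have H2 := green_Phi; have H3 := green_B.
have -> : \int[nu]_(x in D) rhoLu x = Phi - (1 - e) * P - \int[nu]_(x in D) q1 x.
  by rewrite -H2; ring.
have -> : P = (B + a * (beta - 2) * J) / 2 by rewrite -H3; field.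
have {}H1 := ler_wpM2l (mulr_ge0 (ler0n R 2) c0) H1.
rewrite -subr_ge0 in H1; rewrite -subr_ge0; apply: (le_trans H1).
rewrite le_eqVlt; apply/orP; left; apply/eqP.
by rewrite /c he /a; field.
Qed.
End FiniteEnergy.

Lemma integral_domain_eq (f g : M -> R) : (forall x, 0 <= f x) -> (forall x, D x -> f x = g x) ->
  nu.-integrable D (EFin \o g) ->
  (\int[nu]_(x in Omega) (f x)%:E = (\int[nu]_(x in D) g x)%:E)%E.
Proof.
move=> f0 fg gi; have mD := measurable_punctured.
have fi : nu.-integrable D (EFin \o f).
  by apply: (eq_integrable mD _ _ _ gi) => x; rewrite inE => Dx /=; rewrite fg.
rewrite (ge0_integral_domain (measurable_int _ fi)); last by move=> x; rewrite lee_fin.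
rewrite /Rintegral fineK; last exact: (integrable_fin_num mD gi).
by apply: eq_integral => x; rewrite inE => Dx /=; rewrite fg.
Qed.

Lemma rellich_dim_pos :
  let d := fun x => G x `^ (2 - beta)^-1 in
  let lhs := (\int[nu]_(x in Omega)
    ((G x `^ (alpha / (2 - beta)))%:E * (gradX_sqr X d x)%:E^-1
     * (`|Lop X u x| ^+ 2)%:E))%E in
  let J := (\int[nu]_(x in Omega)
    (G x `^ ((alpha - 4) / (2 - beta)) * gradX_sqr X d x
     * `|u x| ^+ 2)%:E)%E in
  let Jlog := (\int[nu]_(x in Omega)
    (G x `^ ((alpha - 4) / (2 - beta)) * gradX_sqr X d x
     * (ln (K / d x)) ^- 2 * `|u x| ^+ 2)%:E)%E in
  let B := flux w X S
    (fun x => G x `^ ((alpha - 2) / (2 - beta) - 1) * `|u x| ^+ 2)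
    (fun k => Xder (X k) G) in
  let Blog := flux w X S
    (fun x => G x `^ ((alpha - 2) / (2 - beta) - 1)
              * (ln (K / d x))^-1 * `|u x| ^+ 2)
    (fun k => Xder (X k) G) in
  let C := Cbdry w X S Omega G alpha beta u in
  (lhs >=
     ((beta + alpha - 4) ^+ 2 * (beta - alpha) ^+ 2 / 16)%:E * J
     + ((beta + alpha - 4) ^+ 2 * (beta - alpha) / (4 * (beta - 2)) * B)%:E
     + ((beta + alpha - 4) * (beta - alpha) / 4 * C)%:E)%E
  /\
  (lhs >=
     ((beta + alpha - 4) ^+ 2 * (beta - alpha) ^+ 2 / 16)%:E * J
     + ((beta + alpha - 4) * (beta - alpha) / 8)%:E * Jlog
     + ((beta + alpha - 4) * (beta - alpha) / (4 * (beta - 2)) * Blog)%:E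
     + ((beta + alpha - 4) ^+ 2 * (beta - alpha) / (4 * (beta - 2)) * B)%:E
     + ((beta + alpha - 4) * (beta - alpha) / 4 * C)%:E)%E.
Proof.
move=> d0 lhs JO JlogO BO BlogO C.
(* An infinite left-hand side leaves nothing to prove; a finite one supplies the integrability of
   [rhoLu]. *)
have [lhs_fin|] := ltP lhs +oo%E; last first.
  by rewrite leye_eq => /eqP ->; split; exact: leey.
have sq x : `|u x| ^+ 2 = u x ^+ 2 by rewrite real_normK ?num_real.
have ex : (alpha - 2) / (2 - beta) = 1 - e by rewrite he; field; rewrite b2 b2'.
have JE : JO = J%:E.
  apply: integral_domain_eq integrable_Wu => x.
    by rewrite !mulr_ge0 ?powR_ge0 ?gradX_ge0 ?exprn_ge0.
  by move=> Dx; rewrite sq weightE.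
have JlogE : JlogO = J2%:E.
  apply: integral_domain_eq i6 => x.
    rewrite mulr_ge0 ?exprn_ge0// mulr_ge0 -?exprVn ?sqr_ge0//.
    by rewrite mulr_ge0 ?powR_ge0 ?gradX_ge0.
  move=> Dx; have [cx xy] := D_clO Dx.
  by rewrite sq weightE// logdistE// /q6 /Wu /kap; ring.
have BE : BO = B.
  by congr flux; apply/funext => x; rewrite sq ex /F1 (_ : 1 - e - 1 = - e)//; ring.
have hS : presents A S (closure (Omega : set M) `\` Omega) by case: hOmega => -[].
have BlogE : BlogO = Blog.
  (* The two logarithms are known to agree only on the closure off the pole, so the fluxes are
     compared through boundary values. *)
  apply: (@eq_flux _ _ _ _ w _ _ _ _ hS) => x k bx; have [cx xy] := bd_clO bx.
  by rewrite sq logdistE// ex /F2 (_ : 1 - e - 1 = - e)//; ring.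
have CE : C = (1 - e) * B - 2 * Phi.
  rewrite /C /Cbdry ex; congr (_ * _ - _ * _).
    by congr flux; apply/funext => x; rewrite /F1 mulrC (_ : 1 - e - 1 = - e)//; ring.
rewrite JE JlogE BE BlogE CE; split.
  (* With [s = 0] both logarithmic terms disappear. *)
  apply: le_trans (rellich lhs_fin 0); rewrite -!EFinM -!EFinD lee_fin.
  by rewrite le_eqVlt; apply/orP; left; apply/eqP; rewrite /a; field.
(* The value [s = 1 / 2] maximizes [s - s^2]; the maximum 1/4 gives the coefficient with denominator
   8. *)
apply: le_trans (rellich lhs_fin (1 / 2)); rewrite -!EFinM -!EFinD lee_fin.
by rewrite le_eqVlt; apply/orP; left; apply/eqP; rewrite /a; field.
Qed.
End Rellich.
End Setting.

(** * Manifolds of dimension zero *)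

Section DimensionZero.
Variables (R : realType) (M : ptopologicalType) (A : manifold R 0 M) (w : volume_form A).
Variables (N : nat) (X : 'I_N -> vector_field A) (S : patches R 0 M) (Omega : set M).
Hypothesis hS : presents A S (closure Omega `\` Omega).

(** Coordinates take values in a one-point space, so every chart domain is an open singleton and the
    topology is discrete. *)
Lemma closure_dim0 : closure Omega `<=` Omega.
Proof.
move=> x cx; pose i := chart_at A x; have ix : dom i x by exact: chart_atP.
have [z [Oz iz]] := cx _ (open_nbhs_nbhs (conj (dom_open i) ix)).
suff -> : x = z by [].
by rewrite -(crdK ix) -(crdK iz); congr (par i _); apply/rowP => -[].
Qed.

(** The boundary is empty, hence there is no patch: the image of a point of the cube would lie in
    it. *)
Lemma flux_dim0 f p : flux w X S f p = 0.
Proof.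
apply: big1 => j _; case: hS => _ _ B _.
have : (closure Omega `\` Omega) (Defs.patch S j 0).
  by rewrite B; exists j => //; exists 0 => // -[].
by move=> [/closure_dim0].
Qed.
End DimensionZero.

Theorem theorem4p1
  (R : realType) (n : nat) (M : ptopologicalType) (A : manifold R n M)
  (w : volume_form A) (nu : {measure set (borel M) -> \bar R})
  (hnu : is_volume_measure w nu)
  (N : nat) (hN : (N <= n)%N) (X : 'I_N -> vector_field A)
  (y : M) (T : set M) (Gamma : M -> R)
  (hA : assumption_Aplus nu X y T Gamma)
  (Omega : set (borel M)) (S : patches R n M)
  (hOmega : strongly_admissible w nu X S Omega y T Gamma)
  (hy : ~ (closure (Omega : set M) `\` Omega) y)
  (alpha beta K : R)
  (hab : alpha < beta) (hba : 4 - beta < alpha) (hb : 2 < beta)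
  (hK : ((expR 1)%:E * ereal_sup
           [set (Gamma x `^ (2 - beta)^-1)%:E | x in (Omega `\ y)%classic]
         <= K%:E)%E)
  (u : M -> R) (hu2 : C2X X Omega u) (hu1 : C1Xbar X Omega u) :
  let d := fun x => Gamma x `^ (2 - beta)^-1 in
  let lhs := (\int[nu]_(x in Omega)
    ((Gamma x `^ (alpha / (2 - beta)))%:E * (gradX_sqr X d x)%:E^-1
     * (`|Lop X u x| ^+ 2)%:E))%E in
  let J := (\int[nu]_(x in Omega)
    (Gamma x `^ ((alpha - 4) / (2 - beta)) * gradX_sqr X d x
     * `|u x| ^+ 2)%:E)%E in
  let Jlog := (\int[nu]_(x in Omega)
    (Gamma x `^ ((alpha - 4) / (2 - beta)) * gradX_sqr X d x
     * (ln (K / d x)) ^- 2 * `|u x| ^+ 2)%:E)%E in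
  let B := flux w X S
    (fun x => Gamma x `^ ((alpha - 2) / (2 - beta) - 1) * `|u x| ^+ 2)
    (fun k => Xder (X k) Gamma) in
  let Blog := flux w X S
    (fun x => Gamma x `^ ((alpha - 2) / (2 - beta) - 1)
              * (ln (K / d x))^-1 * `|u x| ^+ 2)
    (fun k => Xder (X k) Gamma) in
  let C := Cbdry w X S Omega Gamma alpha beta u in
  (lhs >=
     ((beta + alpha - 4) ^+ 2 * (beta - alpha) ^+ 2 / 16)%:E * J
     + ((beta + alpha - 4) ^+ 2 * (beta - alpha) / (4 * (beta - 2)) * B)%:E
     + ((beta + alpha - 4) * (beta - alpha) / 4 * C)%:E)%E
  /\
  (lhs >=
     ((beta + alpha - 4) ^+ 2 * (beta - alpha) ^+ 2 / 16)%:E * J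
     + ((beta + alpha - 4) * (beta - alpha) / 8)%:E * Jlog
     + ((beta + alpha - 4) * (beta - alpha) / (4 * (beta - 2)) * Blog)%:E
     + ((beta + alpha - 4) ^+ 2 * (beta - alpha) / (4 * (beta - 2)) * B)%:E
     + ((beta + alpha - 4) * (beta - alpha) / 4 * C)%:E)%E.
Proof.
case: n A w hnu hN X hA S hOmega hu2 hu1 => [|n'] A w hnu hN X hA S hOmega hu2 hu1.
  (* In dimension 0, [N <= n] leaves no field and the boundary is empty: both right-hand sides are 0
     and the left-hand side is nonnegative. *)
  have N0 : N = 0%N by apply/eqP; rewrite -leqn0.
  have hS : presents A S (closure (Omega : set M) `\` Omega) by case: hOmega => -[].
  move=> d lhs J Jlog B Blog C.
  have g0 x : gradX_sqr X d x = 0 by apply: big1 => k; have := ltn_ord k; rewrite {2}N0.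
  have J0 : J = 0%E by apply: integral0_eq => x _; rewrite g0 mulr0 mul0r.
  have Jlog0 : Jlog = 0%E by apply: integral0_eq => x _; rewrite g0 mulr0 !mul0r.
  have lhs0 : (0 <= lhs)%E.
    apply: integral_ge0 => x _.
    by rewrite !mule_ge0 ?inve_ge0 ?lee_fin ?powR_ge0 ?g0 ?exprn_ge0.
  rewrite J0 Jlog0 /B /Blog /C /Cbdry !(flux_dim0 w X hS).
  by rewrite !(mulr0, mule0, subr0, adde0).
(* [erefl] fixes [e] as [(beta + alpha - 4) / (beta - 2)]; the remaining goal is its positivity. *)
apply: (rellich_dim_pos hnu hA hOmega hy _ hu2 hu1 hab hba hb (erefl _) hK).
by rewrite divr_gt0 ?subr_gt0// -ltrBlDr; lra.
Qed.
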